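(* Let $\mathcal{S}$ be the class of separable permutations. Two separable permutations $\sigma,\tau$ are equipopular in $\mathcal{S}$ (that is, $\nu_\sigma(\mathcal{S}_m)=\nu_\tau(\mathcal{S}_m)$ for all $m\ge 1$) if and only if their decomposition trees $\Gamma(\sigma)$ and $\Gamma(\tau)$ have the same signature. Therefore, for every $n\ge 1$, the set of partitions of the integer $n-1$ is in bijection with the set of equipopularity classes of separable patterns of length $n$ in the separable permutations.
   Context: Permutations are nonempty and written in one-line notation. For permutations $\sigma,\tau$ of lengths $n,m$, the direct sum $\sigma\oplus\tau$ is the permutation of length $n+m$ with $(\sigma\oplus\tau)(i)=\sigma(i)$ for $i\le n$ and $\tau(i-n)+n$ for $i>n$; the skew sum $\sigma\ominus\tau$ has $(\sigma\ominus\tau)(i)=\sigma(i)+m$ for $i\le n$ and $\tau(i-n)$ for $i>n$. Both operations are associative. The class $\mathcal{S}$ of separable permutations is the smallest set containing the length-one permutation $1$ and closed under $\oplus$ and $\ominus$; $\mathcal{S}_n$ is the set of those of length $n$. A permutation is sum decomposable if it is a direct sum of two nonempty permutations, and sum indecomposable otherwise; skew (in)decomposable is defined analogously with $\ominus$. An occurrence of a pattern $\sigma$ of length $k$ in $\pi$ is a set of indices $i_1<\dots<i_k$ such that $\pi(i_1),\dots,\pi(i_k)$ has the same relative order as $\sigma(1),\dots,\sigma(k)$. $\nu_\sigma(\pi)$ is the number of occurrences of $\sigma$ in $\pi$, and $\nu_\sigma(\mathcal{X})=\sum_{\pi\in\mathcal{X}}\nu_\sigma(\pi)$ for a finite set $\mathcal{X}$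 of permutations. Equipopularity in $\mathcal{S}$ is the equivalence relation on $\mathcal{S}$ defined by $\sigma\sim\tau$ iff $\nu_\sigma(\mathcal{S}_m)=\nu_\tau(\mathcal{S}_m)$ for all $m\ge1$; its equivalence classes are the equipopularity classes (any two equipopular separable permutations have the same length). A decomposition tree is a rooted plane tree in which every non-leaf (internal) node is labelled $\oplus$ or $\ominus$ and has at least two children, and the internal children of a node labelled $\oplus$ are labelled $\ominus$ and vice versa. The bijection $\Gamma$ from $\mathcal{S}$ to decomposition trees is defined recursively: $\Gamma(1)$ is a single node; if $\pi=\sigma_1\oplus\dots\oplus\sigma_k$ with $k\ge2$ and all $\sigma_i$ sum indecomposable, $\Gamma(\pi)$ has a root labelled $\oplus$ whose $k$ child subtrees are $\Gamma(\sigma_1),\dots,\Gamma(\sigma_k)$ in that order; if $\pi$ is skew decomposable, the same with $\ominus$ and skew indecomposable components. The signature of a decomposition tree $T$ with internal nodes $i_1,\dots,i_r$ is the multiset $\{d(i_j)-1\}_{j=1}^r$, where $d(i_j)$ is the number of children of $i_j$. (The single-node tree has empty signature.) The signature of a tree with $n$ leaves is a partition of $n-1$. *)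

(* Defs.v *)
From mathcomp Require Import all_boot fingroup perm.
From mathcomp Require Import boolp classical_sets functions.

Set Implicit Arguments.
Unset Strict Implicit.
Unset Printing Implicit Defensive.

(* Permutations of arbitrary length, indexed from 0.  The empty permutation is
   an element of this type; it is neither separable nor sum or skew
   indecomposable, and it only serves as the unit of the iterated sums. *)
Definition permutation := {n : nat & 'S_n}.

Definition mkperm n (p : 'S_n) : permutation := Tagged (fun n => 'S_n) p.
Definition plen (p : permutation) : nat := tag p.
Definition empty_perm : permutation := mkperm (1%g : 'S_0).
Definition one_perm : permutation := mkperm (1%g : 'S_1).

Section Sums.
Variables (n m : nat) (s : 'S_n) (t : 'S_m).

Definition dsum_fun (i : 'I_(n + m)) : 'I_(n + m) :=
  match fintype.split i with
  | inl j => lshift m (s j)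
  | inr j => rshift n (t j)
  end.

Lemma dsum_fun_inj : injective dsum_fun.
Proof.
move=> i j; rewrite /dsum_fun => h; apply: (can_inj splitK); move: h.
case: (fintype.split i) => a; case: (fintype.split j) => b /eqP.
- by rewrite eq_lshift => /eqP /perm_inj ->.
- by rewrite eq_lrshift.
- by rewrite eq_rlshift.
- by rewrite eq_rshift => /eqP /perm_inj ->.
Qed.

(* The casts identify 'I_(m + n) with 'I_(n + m): the value of the first
   branch is s j + m, and that of the second branch is t j. *)
Definition ssum_fun (i : 'I_(n + m)) : 'I_(n + m) :=
  match fintype.split i with
  | inl j => cast_ord (addnC m n) (rshift m (s j))
  | inr j => cast_ord (addnC m n) (lshift n (t j))
  end.

Lemma ssum_fun_inj : injective ssum_fun.
Proof.
move=> i j; rewrite /ssum_fun => h; apply: (can_inj splitK); move: h.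
case: (fintype.split i) => a; case: (fintype.split j) => b /cast_ord_inj /eqP.
- by rewrite eq_rshift => /eqP /perm_inj ->.
- by rewrite eq_rlshift.
- by rewrite eq_lrshift.
- by rewrite eq_lshift => /eqP /perm_inj ->.
Qed.

End Sums.

Definition dsum (p q : permutation) : permutation :=
  mkperm (perm (@dsum_fun_inj _ _ (tagged p) (tagged q))).
Definition ssum (p q : permutation) : permutation :=
  mkperm (perm (@ssum_fun_inj _ _ (tagged p) (tagged q))).

Inductive separable : permutation -> Prop :=
| separable1 : separable one_perm
| separable_dsum p q : separable p -> separable q -> separable (dsum p q)
| separable_ssum p q : separable p -> separable q -> separable (ssum p q).

Definition separables m : {set 'S_m} :=
  [set p : 'S_m | `[< separable (mkperm p) >]]%SET.

Definition sum_decomposable (p : permutation) : Prop :=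
  exists q r, [/\ 0 < plen q, 0 < plen r & p = dsum q r].
Definition skew_decomposable (p : permutation) : Prop :=
  exists q r, [/\ 0 < plen q, 0 < plen r & p = ssum q r].
Definition sum_indecomposable (p : permutation) : Prop :=
  0 < plen p /\ ~ sum_decomposable p.
Definition skew_indecomposable (p : permutation) : Prop :=
  0 < plen p /\ ~ skew_decomposable p.

(* An index set i_1 < ... < i_k is encoded by its increasing enumeration. *)
Definition occurrences k n (s : 'S_k) (p : 'S_n) : {set {ffun 'I_k -> 'I_n}} :=
  [set f : {ffun 'I_k -> 'I_n} |
    [forall a : 'I_k, forall b : 'I_k, (a < b) ==> (f a < f b)] &&
    [forall a : 'I_k, forall b : 'I_k, (p (f a) < p (f b)) == (s a < s b)]]%SET.

Definition popularity (s : permutation) m (X : {set 'S_m}) : nat :=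
  \sum_(p in X) #|occurrences (tagged s) p|.

Definition equipopular (s t : permutation) : Prop :=
  forall m, 1 <= m -> popularity s (separables m) = popularity t (separables m).

Variant label := Oplus | Ominus.

Inductive dtree := Leaf | Node of label & seq dtree.

Fixpoint signature (T : dtree) : seq nat :=
  match T with
  | Leaf => [::]
  | Node _ Ts => (size Ts).-1 :: flatten [seq signature U | U <- Ts]
  end.

(* The graph of Gamma.  The trees reached have at least two children at every
   internal node, and their labels alternate because a sum (resp. skew)
   indecomposable permutation never yields a root labelled Oplus (resp.
   Ominus). *)
Inductive Gamma_graph : permutation -> dtree -> Prop :=
| Gamma_leaf : Gamma_graph one_perm Leaf
| Gamma_oplus (ps : seq permutation) (f : permutation -> dtree) :
    1 < size ps ->
    (forall p : permutation, p \in ps -> sum_indecomposable p) ->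
    (forall p : permutation, p \in ps -> Gamma_graph p (f p)) ->
    Gamma_graph (\big[dsum/empty_perm]_(p <- ps) p) (Node Oplus [seq f p | p <- ps])
| Gamma_ominus (ps : seq permutation) (f : permutation -> dtree) :
    1 < size ps ->
    (forall p : permutation, p \in ps -> skew_indecomposable p) ->
    (forall p : permutation, p \in ps -> Gamma_graph p (f p)) ->
    Gamma_graph (\big[ssum/empty_perm]_(p <- ps) p) (Node Ominus [seq f p | p <- ps]).

(* Every separable permutation has exactly one tree; Leaf is a dummy value for
   the other permutations. *)
Definition Gamma (p : permutation) : dtree :=
  if pselect (exists T, Gamma_graph p T) is left h then sval (cid h) else Leaf.

Local Open Scope classical_set_scope.

Definition int_partitions k : set (seq nat) :=
  [set l | [/\ sorted geq l, 0 \notin l & sumn l = k]].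

Definition equipop_class (p : permutation) : set permutation :=
  [set q | separable q /\ equipopular p q].

Definition equipop_classes n : set (set permutation) :=
  [set equipop_class p | p in [set p | separable p /\ plen p = n]].

(* Main.v *)
Require Import Defs.
From HB Require Import structures.
From mathcomp Require Import all_boot fingroup perm.
From mathcomp Require Import boolp classical_sets functions.
From mathcomp Require Import all_order ssralg ssrnum ssrint poly.
From mathcomp Require Import interval realalg polyrcf.
From mathcomp Require Import zify ring lra.

(* For a pattern s, let F_s be the generating function over the separable
   permutations p, by length, of the number of occurrences of s in p.  Cutting
   p at its first sum (or skew) component turns occurrences into pairs of
   occurrences of the two parts of a cut of s.  Let Q be the generating function
   of the sum-indecomposable separable permutations (equivalently, of the
   skew-indecomposable ones), D = 1 / (1 - Q)^2 - 1, and N_j the Narayana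
   polynomials (N_0 = N_1 = 1, N_2 = 1 + X).  If s is the sum, or skew sum, of
   k + 1 indecomposable components s_i, these equations solve to
     (1 - D)^k F_s = (1 - Q)^k N_k(D) prod_i F_{s_i},
   so that, if s has length n and F_1 counts the pairs (p, entry of p),
     (1 - D)^(n-1) F_s = (1 - Q)^(n-1) F_1^n prod_{k in signature of s} N_k(D).
   Hence F_s only depends on the signature.  Conversely F_s determines n (by its
   valuation) and, D being transcendental, the product of the polynomials N_k;
   as their largest real roots strictly increase for k >= 2, this product and
   the sum n - 1 of the signature determine the signature. *)

Set Implicit Arguments.
Unset Strict Implicit.
Unset Printing Implicit Defensive.

(** * Words of permutations and direct and skew cuts *)

(** Words give permutations of all lengths the common type [seq nat], where cutting and
    concatenating need no casts between ordinals. *)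
HB.lock Definition word (p : permutation) : seq nat :=
  [seq val (tagged p i) | i <- fintype.enum 'I_(plen p)].

Lemma size_word p : size (word p) = plen p.
Proof. by rewrite word.unlock size_map size_enum_ord. Qed.

Lemma word_perm n (s : 'S_n) : word (mkperm s) = [seq val (s i) | i <- fintype.enum 'I_n].
Proof. by rewrite word.unlock. Qed.

Lemma nth_word n (s : 'S_n) (i : 'I_n) : nth 0 (word (mkperm s)) i = s i.
Proof. by rewrite word_perm (nth_map i) ?size_enum_ord // nth_ord_enum. Qed.

Lemma word_inj : injective word.
Proof.
move=> [n s] [m t] eq_w.
have enm : n = m by have := congr1 size eq_w; rewrite !size_word.
subst m; congr existT; apply/permP=> i; apply/val_inj => /=.
by rewrite -!nth_word; congr nth.
Qed.

Lemma perm_word p : perm_eq (word p) (iota 0 (plen p)).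
Proof.
apply: uniq_perm; rewrite ?iota_uniq //.
  by rewrite word.unlock map_inj_uniq ?enum_uniq // => i j /val_inj /perm_inj.
move=> x; rewrite mem_iota /= add0n word.unlock; apply/mapP/idP.
  by move=> [i _ ->]; exact: ltn_ord.
move=> lt_x; exists (perm_inv (tagged p) (Ordinal lt_x)); rewrite ?mem_enum //.
by rewrite permKV.
Qed.

Lemma word_surj w : perm_eq w (iota 0 (size w)) -> exists p, word p = w.
Proof.
move=> pw; set n := size w in pw.
have lt_w (i : 'I_n) : nth 0 w i < n.
  have: nth 0 w i \in w by rewrite mem_nth.
  by rewrite (perm_mem pw) mem_iota.
have inj_f : injective (fun i : 'I_n => Ordinal (lt_w i)).
  move=> i j [] /eqP; rewrite nth_uniq // ?(perm_uniq pw) ?iota_uniq //.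
  by move=> /eqP /val_inj.
exists (mkperm (perm inj_f)); apply: (@eq_from_nth _ 0).
  by rewrite size_word.
rewrite size_word => i lt_i.
by rewrite (nth_word _ (Ordinal lt_i)) permE.
Qed.

Definition gsum (b : bool) : permutation -> permutation -> permutation :=
  if b then dsum else ssum.

Lemma word_dsum p q : word (dsum p q) = word p ++ [seq plen p + x | x <- word q].
Proof.
apply: (@eq_from_nth _ 0).
  by rewrite size_cat size_map !size_word.
rewrite size_word => i lt_i; case: p q lt_i => [n s] [m t] lt_i.
rewrite (nth_word _ (Ordinal lt_i)) permE nth_cat size_word /=.
rewrite /dsum_fun; case: (split_ordP (Ordinal lt_i)) => j /(congr1 val) /= ->.
  by rewrite ?ltn_ord nth_word.
rewrite ?ltnNge ?leq_addr /= (nth_map 0) ?size_word ?addKn //.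
by rewrite nth_word.
Qed.

Lemma word_ssum p q : word (ssum p q) = [seq plen q + x | x <- word p] ++ word q.
Proof.
apply: (@eq_from_nth _ 0).
  by rewrite size_cat size_map !size_word.
rewrite size_word => i lt_i; case: p q lt_i => [n s] [m t] lt_i.
rewrite (nth_word _ (Ordinal lt_i)) permE nth_cat size_map size_word /=.
rewrite /ssum_fun; case: (split_ordP (Ordinal lt_i)) => j /(congr1 val) /= ->.
  by rewrite ?ltn_ord (nth_map 0) ?size_word // nth_word.
by rewrite ?ltnNge ?leq_addr /= addKn nth_word.
Qed.

Lemma word_gsum b p q : word (gsum b p q) =
  if b then word p ++ [seq plen p + x | x <- word q]
  else [seq plen q + x | x <- word p] ++ word q.
Proof. by case: b; [exact: word_dsum|exact: word_ssum]. Qed.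

Lemma plen_gsum b p q : plen (gsum b p q) = plen p + plen q.
Proof. by case: b. Qed.

Lemma word_empty : word empty_perm = [::].
Proof. by apply/nilP; rewrite /nilp size_word. Qed.

Lemma word_one : word one_perm = [:: 0].
Proof. by have /perm_small_eq := perm_word one_perm; apply. Qed.

Lemma plen1 p : plen p = 1 -> p = one_perm.
Proof.
move=> p1; apply: word_inj; rewrite word_one.
by have := perm_word p; rewrite p1 => /perm_small_eq; apply.
Qed.

Lemma gsumA b : associative (gsum b).
Proof.
move=> p q r; apply: word_inj; rewrite !word_gsum !plen_gsum.
case: b; rewrite map_cat ?catA -?map_comp; congr (_ ++ _); last congr (_ ++ _).
  by apply: eq_map => x /=; rewrite addnA.
by apply: eq_map => x /=; rewrite addnCA addnA.
Qed.

Lemma gsum0p b : left_id empty_perm (gsum b).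
Proof.
move=> p; apply: word_inj; rewrite word_gsum word_empty.
by case: b; rewrite /= ?cats0 ?map_id_in.
Qed.

Lemma gsump0 b : right_id empty_perm (gsum b).
Proof.
move=> p; apply: word_inj; rewrite word_gsum word_empty cats0.
by case: b; rewrite /= ?cats0 ?map_id_in.
Qed.

HB.instance Definition _ b :=
  Monoid.isLaw.Build permutation empty_perm (gsum b)
    (@gsumA b) (@gsum0p b) (@gsump0 b).

(* The sign [b] treats sums ([true]) and skew sums ([false]) uniformly: a
   permutation is a [gsum b] of two parts, the first of length [j], iff its word
   satisfies [cut b _ j]. *)
Definition below (b : bool) (x y : nat) := if b then x < y else y < x.

Definition cut b (w : seq nat) j := allrel (below b) (take j w) (drop j w).

(** The bounds of [iota] leave out the trivial cuts at both ends. The empty word and the words of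
    one letter pass the test. *)
Definition gindec b (w : seq nat) := ~~ has (cut b w) (iota 1 (size w).-1).

Lemma gindecP b w :
  reflect (exists j, [/\ 0 < j, j < size w & cut b w j]) (~~ gindec b w).
Proof.
rewrite negbK; apply: (iffP hasP) => -[j].
  by rewrite mem_iota => lt_j cj; exists j; split=> //; lia.
by move=> [lt0 lt1 cj]; exists j => //; rewrite mem_iota; lia.
Qed.

Lemma cut0 b w : cut b w 0.
Proof. by rewrite /cut take0. Qed.

Lemma cut_oversize b w j : size w <= j -> cut b w j.
Proof. by move=> le_j; rewrite /cut drop_oversize // allrel0r. Qed.

Lemma cutP b w j :
  reflect (forall i k, i < j -> j <= k < size w -> below b (nth 0 w i) (nth 0 w k)) (cut b w j).
Proof.
apply: (iffP allrelP) => [h i k lt_i /andP[le_k lt_k]|h x y].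
  apply: h.
    rewrite -(nth_take 0 lt_i); apply: mem_nth; rewrite size_take; case: ifP => // _.
    exact: ltn_trans lt_i (leq_ltn_trans le_k lt_k).
  rewrite -[k](subnKC le_k) -nth_drop; apply: mem_nth.
  by rewrite size_drop ltn_sub2r // (leq_ltn_trans le_k).
move=> /(nthP 0)[i + <-] /(nthP 0)[k + <-].
rewrite size_take_min leq_min size_drop ltn_subRL => /andP[lt_ij _] lt_k.
by rewrite nth_take // nth_drop; apply: h; rewrite ?leq_addr.
Qed.

Lemma belowDl b k x y : below b (k + x) (k + y) = below b x y.
Proof. by case: b; rewrite /below ltn_add2l. Qed.

Lemma cut_shift b k w j : cut b [seq k + x | x <- w] j = cut b w j.
Proof.
rewrite /cut -map_take -map_drop allrel_mapl allrel_mapr.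
by apply: eq_allrel => x y; rewrite belowDl.
Qed.

Lemma word_ltn p x : x \in word p -> x < plen p.
Proof. by rewrite (perm_mem (perm_word p)) mem_iota. Qed.

(** The letters of the left summand already compare correctly with those of the right one, so only
    the cut inside the left summand remains to be tested. *)
Lemma cut_gsum_le b p q j : j <= plen p ->
  cut b (word (gsum b p q)) j = cut b (word p) j.
Proof.
move=> le_j; rewrite word_gsum.
have cutE u v : size u = plen p -> allrel (below b) u v -> cut b (u ++ v) j = cut b u j.
  move=> su uv; rewrite /cut takel_cat ?su // drop_cat su.
  case: ltngtP le_j => // [lt_j|ej] _; last first.
    by rewrite ej subnn drop0 -su take_size drop_size allrel0r.
  rewrite allrel_catr; case: (boolP (allrel _ _ (drop j u))) => //= _.
  by apply/allrelP=> x y /mem_take xu yv; apply: (allrelP uv).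
case: b cutE => cutE; rewrite cutE ?size_word 1?size_map ?size_word ?cut_shift //;
  apply/allrelP=> x y.
  by move=> /word_ltn xp /mapP[z _ ->]; rewrite /below ltn_addr.
by move=> /mapP[z _ ->] /word_ltn xp; rewrite /below ltn_addr.
Qed.

Lemma cut_gsum_ge b p q j : plen p <= j ->
  cut b (word (gsum b p q)) j = cut b (word q) (j - plen p).
Proof.
move=> le_j; rewrite word_gsum.
have cutE u v : size u = plen p -> allrel (below b) u v ->
    cut b (u ++ v) j = cut b v (j - plen p).
  move=> su uv; rewrite /cut take_cat drop_cat su ltnNge le_j /=.
  rewrite allrel_catl; case: (boolP (allrel _ (take _ v) _)); rewrite ?andbF ?andbT //.
  by move=> _; apply/allrelP=> x y xu /mem_drop yv; apply: (allrelP uv).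
case: b cutE => cutE; rewrite cutE ?size_word 1?size_map ?size_word ?cut_shift //;
  apply/allrelP=> x y.
  by move=> /word_ltn xp /mapP[z _ ->]; rewrite /below ltn_addr.
by move=> /mapP[z _ ->] /word_ltn xp; rewrite /below ltn_addr.
Qed.

(** Sorting [u] and [v] separately already sorts [u ++ v]; the sorted arrangement being unique, it
    is the [iota] list, which splits at [size u]. *)
Lemma cat_sort_iota (u v : seq nat) : perm_eq (u ++ v) (iota 0 (size u + size v)) ->
  allrel ltn u v ->
  perm_eq u (iota 0 (size u)) /\ perm_eq v (iota (size u) (size v)).
Proof.
move=> puv luv.
have: sort leq u ++ sort leq v = iota 0 (size u + size v).
  apply: (sorted_eq leq_trans anti_leq); last first.
  - by apply: perm_trans puv; apply: perm_cat; rewrite perm_sort.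
  - exact: iota_sorted.
  rewrite sorted_pairwise; last exact: leq_trans.
  rewrite pairwise_cat -!(sorted_pairwise leq_trans).
  rewrite !(sort_sorted leq_total) !andbT.
  by apply/allrelP=> x y; rewrite !mem_sort => xu yv; apply: ltnW; apply: (allrelP luv).
rewrite iotaD => /eqP; rewrite eqseq_cat ?size_sort ?size_iota // => /andP[/eqP <- /eqP <-].
by split; rewrite perm_sym perm_sort.
Qed.

Lemma shift_surj k w : perm_eq w (iota k (size w)) ->
  exists2 p, plen p = size w & w = [seq k + x | x <- word p].
Proof.
move=> pw; have eqw : w = [seq k + x | x <- [seq x - k | x <- w]].
  rewrite -map_comp map_id_in // => x.
  by rewrite (perm_mem pw) mem_iota /= => /andP[? _]; rewrite subnKC.
have [|p wp] := @word_surj [seq x - k | x <- w].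
  rewrite size_map; have := perm_map (fun x => x - k) pw.
  rewrite -[in iota k](addn0 k) iotaDl mapK // => x.
  exact: addKn.
by exists p; rewrite -?size_word wp ?size_map.
Qed.

Lemma cut_gsum b p j : j <= plen p -> cut b (word p) j ->
  exists q r, plen q = j /\ p = gsum b q r.
Proof.
move=> le_j; have := perm_word p; rewrite -size_word in le_j *.
rewrite -{1 2}(cat_take_drop j (word p)) size_cat /cut.
set u := take j _; set v := drop j _ => puv.
have su : size u = j by rewrite size_takel.
case: b => luv.
  have [/shift_surj[q lq uq] /shift_surj[r lr vr]] := cat_sort_iota puv luv.
  exists q, r; split; first by rewrite lq.
  apply: word_inj; rewrite word_dsum -(cat_take_drop j (word p)) -/u -/v vr lq uq.
  by congr (_ ++ _); rewrite map_id.
(* A skew cut of [u ++ v] is a direct cut of [v ++ u], so the same splitting lemma applies. *)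
have {}puv : perm_eq (v ++ u) (iota 0 (size v + size u)).
  by rewrite perm_catC addnC.
have lvu : allrel ltn v u by rewrite allrelC.
have [/shift_surj[r lr vr] /shift_surj[q lq uq]] := cat_sort_iota puv lvu.
exists q, r; split; first by rewrite lq.
apply: word_inj; rewrite word_ssum -(cat_take_drop j (word p)) -/u -/v uq lr vr.
by congr (_ ++ _); rewrite map_id.
Qed.

Lemma gsum_inj b p q p' q' : plen p = plen p' -> gsum b p q = gsum b p' q' -> p = p' /\ q = q'.
Proof.
move=> lp e; have lq : plen q = plen q'.
  by have := congr1 plen e; rewrite !plen_gsum lp => /addnI.
have sp : size (word p) = size (word p') by rewrite !size_word.
have := congr1 word e; rewrite !word_gsum lp lq => /eqP.
case: b {e}; rewrite eqseq_cat ?size_map // => /andP[/eqP e1 /eqP e2].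
  by split; apply: word_inj => //; exact: inj_map (@addnI _) _ _ e2.
by split; apply: word_inj => //; exact: inj_map (@addnI _) _ _ e1.
Qed.

(** The first and the last letter are separated by both cuts, which order them in opposite ways. *)
Lemma cut_excl w i j : 0 < i < size w -> 0 < j < size w -> cut true w i -> cut false w j -> False.
Proof.
move=> hi hj /cutP ci /cutP cj.
have := ci 0 (size w).-1; have := cj 0 (size w).-1; rewrite /below; lia.
Qed.

Lemma gindec_excl b w : ~~ gindec b w -> gindec (~~ b) w.
Proof.
move=> /gindecP[i [i0 i1 ci]]; apply: contraT => /gindecP[j [j0 j1 cj]]; exfalso.
by case: b ci cj => ci cj; [apply: (cut_excl (i := i) (j := j)) ci cj
  | apply: (cut_excl (i := j) (j := i)) cj ci]; apply/andP.
Qed.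

Definition gdecomposable b (p : permutation) : Prop :=
  exists q r, [/\ 0 < plen q, 0 < plen r & p = gsum b q r].

Lemma gdecomposableP b p : reflect (gdecomposable b p) (~~ gindec b (word p)).
Proof.
apply: (iffP (@gindecP b (word p))) => [[j []]|[q [r [q0 r0 ->]]]].
  rewrite size_word => j0 jp cj; have [q [r [lq pE]]] := cut_gsum (ltnW jp) cj.
  exists q, r; rewrite lq; split=> //.
  by move: jp; rewrite pE plen_gsum; lia.
exists (plen q); split=> //; first by rewrite size_word plen_gsum; lia.
by rewrite cut_gsum_le // cut_oversize // size_word.
Qed.

(** This makes the first indecomposable component unique: if the two lengths differed, the shorter
    summand would give a proper cut of the longer one. *)
Lemma gsum_gindec_inj b p q p' q' : 0 < plen p -> 0 < plen p' ->
  gindec b (word p) -> gindec b (word p') -> gsum b p q = gsum b p' q' -> p = p' /\ q = q'.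
Proof.
move=> p0 p0' ip ip' e; apply: (gsum_inj (b := b)) => //.
wlog: p q p' q' p0 p0' ip ip' e / plen p <= plen p'.
  move=> h; case/orP: (leq_total (plen p) (plen p')) => le.
    exact: h p0 p0' ip ip' e le.
  by apply/esym; exact: h p0' p0 ip' ip (esym e) le.
rewrite leq_eqVlt => /orP[/eqP //|lt].
apply: contraTeq ip' => _; apply/gindecP; exists (plen p).
rewrite size_word; split=> //.
rewrite -(cut_gsum_le b q' (ltnW lt)) -e cut_gsum_le // cut_oversize // size_word //.
Qed.

(** * Pattern occurrences in words and in separable permutations *)

Fixpoint subwords T (w : seq T) : seq (seq T) :=
  if w is x :: w' then [seq x :: u | u <- subwords w'] ++ subwords w' else [:: [::]].

Lemma sum_subwords_cat T (w1 w2 : seq T) (phi : seq T -> nat) :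
  \sum_(u <- subwords (w1 ++ w2)) phi u =
  \sum_(u1 <- subwords w1) \sum_(u2 <- subwords w2) phi (u1 ++ u2).
Proof.
elim: w1 phi => [|x w1 IH] phi /=; first by rewrite big_seq1.
by rewrite !big_cat !big_map /= !IH.
Qed.

Lemma subwords_map T U (f : T -> U) w : subwords (map f w) = map (map f) (subwords w).
Proof. by elim: w => //= x w ->; rewrite map_cat -!map_comp. Qed.

Lemma mem_subwords (T : eqType) (u w : seq T) : (u \in subwords w) = subseq u w.
Proof.
elim: w u => [|x w IH] [|y u] //=; rewrite mem_cat.
  by rewrite IH sub0seq orbT.
rewrite IH; case: eqVneq => [->|ne].
  rewrite mem_map ?IH; last by move=> ? ? [].
  by apply/orP/idP => [[//|]|]; [exact: subseq_trans (subseq_cons _ _)|left].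
by case: mapP => // -[? _ [e _]]; rewrite e eqxx in ne.
Qed.

Lemma subwords_uniq (T : eqType) (w : seq T) : uniq w -> uniq (subwords w).
Proof.
elim: w => //= x w IH /andP[xw /IH uw].
rewrite cat_uniq uw andbT map_inj_uniq ?uw; last by move=> ? ? [].
apply/hasP => -[u]; rewrite mem_subwords => /mem_subseq sub /mapP[u' _ eu].
by move: xw; rewrite sub // eu mem_head.
Qed.

(** [pairwise] visits each pair of positions only once, so both strict comparisons have to be
    matched here. *)
Definition compat (x y : nat * nat) :=
  ((x.1 < y.1) == (x.2 < y.2)) && ((y.1 < x.1) == (y.2 < x.2)).

Definition order_iso (v u : seq nat) := (size v == size u) && pairwise compat (zip v u).

(* The pattern [v] is any word with distinct letters, so that no standardization
   is needed when it is cut in two. *)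
Definition nu (v w : seq nat) := count (order_iso v) (subwords w).

Lemma nuE v w : nu v w = \sum_(u <- subwords w) order_iso v u.
Proof. by rewrite /nu -sum1_count big_mkcond. Qed.

Lemma compat_below b x y : below b x.2 y.2 -> compat x y = below b x.1 y.1.
Proof. by rewrite /compat /below; case: b => h; apply/idP/idP; lia. Qed.

(** As [u1] is separated from [u2], the pairs across the two blocks are compatible exactly when [v1]
    and [v2] are separated in the same way. *)
Lemma order_iso_cat b v1 v2 u1 u2 : size v1 = size u1 -> allrel (below b) u1 u2 ->
  order_iso (v1 ++ v2) (u1 ++ u2) =
  [&& allrel (below b) v1 v2, order_iso v1 u1 & order_iso v2 u2].
Proof.
move=> s1; rewrite /order_iso !size_cat s1 eqn_add2l eqxx /=.
case: eqP => [s2|_]; rewrite ?andbF //= zip_cat // pairwise_cat.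
rewrite -{1}(unzip2_zip (eq_leq (esym s1))) -{1}(unzip2_zip (eq_leq (esym s2))).
rewrite -{4}(unzip1_zip (eq_leq s1)) -{4}(unzip1_zip (eq_leq s2)).
rewrite !allrel_mapl !allrel_mapr => /allrelP h; congr (_ && _).
by apply/allrelP/allrelP=> k x y xz yz; have := k x y xz yz;
  rewrite (compat_below (h x y xz yz)).
Qed.

Lemma order_iso_size v u : order_iso v u -> size v = size u.
Proof. by case/andP=> /eqP. Qed.

Lemma order_iso_shiftl k v u : order_iso [seq k + x | x <- v] u = order_iso v u.
Proof.
rewrite /order_iso size_map; congr (_ && _).
have -> : zip [seq k + x | x <- v] u = [seq (k + x.1, x.2) | x <- zip v u].
  by elim: v u => [|x v IH] [|y u] //=; rewrite IH.
by rewrite pairwise_map; apply: eq_pairwise => x y /=; rewrite /compat /= !ltn_add2l.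
Qed.

Lemma order_iso_shiftr k v u : order_iso v [seq k + x | x <- u] = order_iso v u.
Proof.
rewrite /order_iso size_map; congr (_ && _).
have -> : zip v [seq k + x | x <- u] = [seq (x.1, k + x.2) | x <- zip v u].
  by elim: v u => [|x v IH] [|y u] //=; rewrite IH.
by rewrite pairwise_map; apply: eq_pairwise => x y /=; rewrite /compat /= !ltn_add2l.
Qed.

Lemma nu_shiftl k v w : nu [seq k + x | x <- v] w = nu v w.
Proof. by apply: eq_count => u; rewrite order_iso_shiftl. Qed.

Lemma nu_shiftr k v w : nu v [seq k + x | x <- w] = nu v w.
Proof. by rewrite /nu subwords_map count_map; apply: eq_count => u /=; rewrite order_iso_shiftr. Qed.

(** An occurrence splits into its letters in [w1] and those in [w2], which match a prefix and a
    suffix of [v]; the separation of [w1] from [w2] forces the splitting place to be a cut of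
    [v]. *)
Lemma nu_cat b v w1 w2 : allrel (below b) w1 w2 ->
  nu v (w1 ++ w2) =
  \sum_(j < (size v).+1 | cut b v j) nu (take j v) w1 * nu (drop j v) w2.
Proof.
move=> bw; rewrite nuE sum_subwords_cat.
under [RHS]eq_bigr => j _ do rewrite !nuE big_distrl /=.
rewrite [RHS]exchange_big /= big_seq [RHS]big_seq; apply: eq_bigr => u1.
rewrite mem_subwords => /mem_subseq sub1.
under [RHS]eq_bigr => j _ do rewrite big_distrr /=.
rewrite [RHS]exchange_big /= big_seq [RHS]big_seq; apply: eq_bigr => u2.
rewrite mem_subwords => /mem_subseq sub2.
have bu : allrel (below b) u1 u2.
  by apply/allrelP=> x y /sub1 xw /sub2 yw; apply: (allrelP bw).
(* For fixed [u1] and [u2] only the term with [j = size u1] can be nonzero; if [u1] is longer than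
   [v], both sides vanish. *)
case: (leqP (size u1) (size v)) => [le_u|lt_v]; last first.
  rewrite big1 => [|j _].
    apply/eqP; rewrite eqb0; apply/negP=> /order_iso_size e.
    by move: lt_v; rewrite e size_cat ltnNge leq_addr.
  case: (boolP (order_iso _ u1)) => // /order_iso_size e.
  by move: lt_v; rewrite -e size_take_min ltnNge geq_minr.
rewrite -{1}(cat_take_drop (size u1) v) (order_iso_cat (b := b)) ?size_takel //.
have lt_u : size u1 < (size v).+1 by [].
rewrite big_mkcond (bigD1 (Ordinal lt_u)) //= big1 ?addn0 => [|j ne].
  by rewrite -/(cut b v _); case: cut => //=; rewrite mulnb.
case: ifP => // _; case: (boolP (order_iso _ u1)) => // /order_iso_size.
rewrite size_takel; last by rewrite -ltnS.
by move=> e; case/eqP: ne; apply: val_inj.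
Qed.

Lemma nu_gsum b v p q :
  nu v (word (gsum b p q)) =
  \sum_(j < (size v).+1 | cut b v j) nu (take j v) (word p) * nu (drop j v) (word q).
Proof.
rewrite word_gsum; case: b.
  rewrite (nu_cat (b := true)); first by apply: eq_bigr => j _; rewrite nu_shiftr.
  by apply/allrelP=> x y /word_ltn xp /mapP[z _ ->]; rewrite /below ltn_addr.
rewrite (nu_cat (b := false)); first by apply: eq_bigr => j _; rewrite nu_shiftr.
by apply/allrelP=> x y /mapP[z _ ->] /word_ltn xp; rewrite /below ltn_addr.
Qed.

Lemma nu_small v w : size w < size v -> nu v w = 0.
Proof.
move=> lt_wv; apply/eqP; rewrite /nu eqn0Ngt -has_count; apply/hasPn => u.
rewrite mem_subwords => /size_subseq le_u; apply/negP=> /order_iso_size e.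
by move: le_u; rewrite -e leqNgt lt_wv.
Qed.

Lemma pairwise_enum_ord k (r : rel 'I_k) :
  reflect (forall a b : 'I_k, a < b -> r a b) (pairwise r (fintype.enum 'I_k)).
Proof.
case: k r => [|k] r.
  by have -> : fintype.enum 'I_0 = [::]; [apply/nilP; rewrite /nilp size_enum_ord|left; case].
apply: (iffP (pairwiseP ord0)) => [h a b lt_ab|h i j].
  rewrite -(nth_ord_enum ord0 a) -(nth_ord_enum ord0 b).
  by apply: h; rewrite ?inE ?size_enum_ord.
rewrite !inE size_enum_ord => lt_i lt_j lt_ij.
by rewrite -[i]/(val (Ordinal lt_i)) -[j]/(val (Ordinal lt_j)) !nth_ord_enum; apply: h.
Qed.

Lemma subseq_enum_ord n (t : seq 'I_n) :
  subseq t (fintype.enum 'I_n) = sorted (relpre val ltn) t.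
Proof.
have tr : transitive (relpre val ltn : rel 'I_n) by move=> x y z; exact: ltn_trans.
have se : sorted (relpre val ltn) (fintype.enum 'I_n).
  by rewrite -sorted_map val_enum_ord iota_ltn_sorted.
apply/idP/idP => [/subseq_sorted|st]; first exact.
suff -> : t = [seq i <- fintype.enum 'I_n | i \in t] by exact: filter_subseq.
apply: (irr_sorted_eq tr _ st); first by move=> x; exact: ltnn.
- exact: sorted_filter.
- by move=> i; rewrite mem_filter mem_enum andbT.
Qed.

Lemma zip_map2 T A B (f : T -> A) (g : T -> B) s :
  zip (map f s) (map g s) = [seq (f x, g x) | x <- s].
Proof. by elim: s => //= x s ->. Qed.

(** An increasing index map corresponds to the list of its values, which is a subword of the
    enumeration of the indices; the two sides count the same lists. *)
Lemma occurrencesE k n (s : 'S_k) (p : 'S_n) :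
  #|occurrences s p| = nu (word (mkperm s)) (word (mkperm p)).
Proof.
rewrite !word_perm /nu subwords_map count_map -size_filter cardE.
pose g (f : {ffun 'I_k -> 'I_n}) := [seq f i | i <- fintype.enum 'I_k].
rewrite -(size_map g); apply: perm_size; apply: uniq_perm.
- rewrite map_inj_uniq ?enum_uniq // => f f' /eq_in_map e.
  by apply/ffunP=> i; apply: e; rewrite mem_enum.
- by rewrite filter_uniq ?subwords_uniq ?enum_uniq.
have tr : transitive (relpre val ltn : rel 'I_n) by move=> x y z; exact: ltn_trans.
have occP f : (f \in occurrences s p) =
    (g f \in [seq u <- subwords (fintype.enum 'I_n) |
       order_iso [seq val (s i) | i <- fintype.enum 'I_k] [seq val (p i) | i <- u]]).
  rewrite mem_filter mem_subwords subseq_enum_ord (sorted_pairwise tr) pairwise_map.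
  rewrite /order_iso /g !size_map eqxx /= -map_comp.
  rewrite zip_map2.
  rewrite pairwise_map inE andbC; congr (_ && _).
    apply/forallP/pairwise_enum_ord => h a.
      by move=> b _; have /forallP/(_ b)/eqP := h a; have /forallP/(_ a)/eqP := h b;
        rewrite /compat /= => -> ->; rewrite !eqxx.
    apply/forallP => b; have := h a b; have := h b a; rewrite /compat /=.
    case: (ltngtP a b) => [_ _ /(_ isT)|_ /(_ isT) + _|/val_inj ->]; last by rewrite !ltnn.
      by rewrite eq_sym => /andP[].
    by rewrite [X in _ && X]eq_sym => /andP[].
  apply/forallP/pairwise_enum_ord => h a.
    by move=> b lt_ab; have /forallP/(_ b)/implyP := h a; apply.
  by apply/forallP => b; apply/implyP; exact: h.
move=> t; apply/mapP/idP => [[f]|tin]; first by rewrite mem_enum occP => + ->.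
have st : size t == k.
  have := tin; rewrite mem_filter => /andP[/order_iso_size].
  by rewrite size_map size_map size_enum_ord => ->.
have gt : g (finfun (tnth (Tuple st))) = t.
  rewrite -[RHS](map_tnth_enum (Tuple st)); apply: eq_map => i; exact: ffunE.
by exists (finfun (tnth (Tuple st))) => //; rewrite mem_enum occP gt.
Qed.

(** * Separable permutations and their first components *)

Lemma separable_gsum b p q : separable p -> separable q -> separable (gsum b p q).
Proof. by case: b; [exact: separable_dsum|exact: separable_ssum]. Qed.

Lemma separable_plen p : separable p -> 0 < plen p.
Proof. by elim=> // q r _ q0 _ _; rewrite ?(plen_gsum true) ?(plen_gsum false) addn_gt0 q0. Qed.

(** By induction on the derivation of separability. Its last operation has the sign [b], because sum
    and skew decomposability exclude each other; the two splittings are then compared by the lengths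
    of their first parts, and associativity moves the overlap to one side. *)
Lemma separable_gsum_inv b q r : separable (gsum b q r) -> 0 < plen q -> 0 < plen r ->
  separable q /\ separable r.
Proof.
pose P p := forall b q r, p = gsum b q r -> 0 < plen q -> 0 < plen r ->
  separable q /\ separable r.
suff h p : separable p -> P p by move=> /h /(_ b q r erefl).
have step b' p1 p2 : separable p1 -> separable p2 -> P p1 -> P p2 -> P (gsum b' p1 p2).
  move=> s1 s2 IH1 IH2 b0 q0 r0 e lq lr.
  have p10 := separable_plen s1; have p20 := separable_plen s2.
  have eb : b' = b0.
    have /gdecomposableP d0 : gdecomposable b0 (gsum b' p1 p2) by exists q0, r0.
    have /gdecomposableP d1 : gdecomposable b' (gsum b' p1 p2) by exists p1, p2.
    apply/eqP; apply: contraT => nb; have := gindec_excl d0.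
    have -> : ~~ b0 = b' by case: (b') (b0) nb => -[].
    by move=> h; rewrite h in d1.
  subst b0; case: (ltngtP (plen p1) (plen q0)) => cmp.
  - have := cut_oversize b' (eq_leq (size_word p1)).
    rewrite -(cut_gsum_le b' p2 (leqnn _)) e cut_gsum_le ?(ltnW cmp) //.
    move=> /(cut_gsum (ltnW cmp))[p3 [t [l3 eq0]]].
    move: e; rewrite eq0 -gsumA => /(gsum_inj (esym l3))[e1 e2].
    have t0 : 0 < plen t by move: cmp; rewrite eq0 plen_gsum; lia.
    have [st sr] := IH2 _ _ _ e2 t0 lr.
    by split=> //; rewrite -e1; exact: separable_gsum.
  - have := cut_oversize b' (eq_leq (size_word q0)).
    rewrite -(cut_gsum_le b' r0 (leqnn _)) -e cut_gsum_le ?(ltnW cmp) //.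
    move=> /(cut_gsum (ltnW cmp))[p3 [t [l3 ep1]]].
    move: e; rewrite ep1 -gsumA => /(gsum_inj l3)[e1 e2].
    have t0 : 0 < plen t by move: cmp; rewrite ep1 plen_gsum; lia.
    rewrite e1 in ep1; have [sq st] := IH1 _ _ _ ep1 lq t0.
    by split=> //; rewrite -e2; exact: separable_gsum.
  - by have [<- <-] := gsum_inj cmp e.
elim=> [b0 q0 r0 /(congr1 plen)|p1 p2|p1 p2].
- rewrite plen_gsum /plen /=; lia.
- by move=> s1 IH1 s2 IH2; apply: (step true).
- by move=> s1 IH1 s2 IH2; apply: (step false).
Qed.

Definition seps m : seq permutation := [seq mkperm p | p <- fintype.enum (separables m)].

Lemma seps_uniq m : uniq (seps m).
Proof. by rewrite map_inj_uniq ?enum_uniq //; exact: eq_from_Tagged. Qed.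

Lemma mem_seps p m : (p \in seps m) = `[< separable p >] && (plen p == m).
Proof.
apply/mapP/andP => [[s]|[/asboolP sp /eqP <-]].
  rewrite mem_enum inE => sp ->; split=> //.
by exists (tagged p); rewrite /mkperm ?taggedK // mem_enum inE /mkperm taggedK; apply/asboolP.
Qed.

Lemma gdecomposable_gindec b p : gdecomposable b p ->
  exists q r, [/\ 0 < plen q, 0 < plen r, gindec b (word q) & p = gsum b q r].
Proof.
have [n] := ubnP (plen p); elim: n p => // n IH p lt_p [q [r [q0 r0 ep]]].
case: (boolP (gindec b (word q))) => [iq|/gdecomposableP dq]; first by exists q, r.
have [|q' [r' [q'0 r'0 iq' eq]]] := IH q _ dq; first by move: lt_p; rewrite ep plen_gsum; lia.
by exists q', (gsum b r' r); rewrite plen_gsum addn_gt0 r'0 gsumA -eq.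
Qed.

(** A decomposable permutation is in a unique way the sum of an indecomposable [q], of length [i],
    and a nonempty remainder [r]. The terms for [i = 0] and [i = m] are empty because no separable
    permutation has length zero. *)
Lemma sum_decomposables b m (phi : permutation -> nat) :
  \sum_(p <- seps m | ~~ gindec b (word p)) phi p =
  \sum_(i < m.+1) \sum_(q <- seps i | gindec b (word q)) \sum_(r <- seps (m - i)) phi (gsum b q r).
Proof.
pose pairs i := [seq (q, r) | q <- [seq q <- seps i | gindec b (word q)], r <- seps (m - i)].
pose L := [seq gsum b x.1 x.2 | i <- index_iota 0 m.+1, x <- pairs i].
have -> : \sum_(i < m.+1) \sum_(q <- seps i | gindec b (word q))
    \sum_(r <- seps (m - i)) phi (gsum b q r) = \sum_(p <- L) phi p.
  rewrite big_allpairs_dep big_mkord.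
  by apply: eq_bigr => i _; rewrite big_allpairs_dep big_filter.
rewrite -big_filter; apply: perm_big; apply: uniq_perm.
- by rewrite filter_uniq ?seps_uniq.
- apply: allpairs_uniq_dep; rewrite ?iota_uniq //.
    move=> i _; apply: allpairs_uniq; rewrite ?filter_uniq ?seps_uniq //.
    by move=> [? ?] [? ?].
  move=> _ _ /allpairsPdep[i [x [_ ix ->]]] /allpairsPdep[j [y [_ jy ->]]] /=.
  case/allpairsP: ix => -[q r] /= []; rewrite mem_filter !mem_seps.
  move=> /and3P[iq /asboolP sq /eqP lq] _ ->.
  case/allpairsP: jy => -[q' r'] /= []; rewrite mem_filter !mem_seps.
  move=> /and3P[iq' /asboolP sq' /eqP lq'] _ -> /= e.
  have [eq er] := gsum_gindec_inj (separable_plen sq) (separable_plen sq') iq iq' e.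
  by rewrite -lq -lq' eq er.
move=> p; rewrite mem_filter mem_seps; apply/idP/idP.
  move=> /and3P[/gdecomposableP/gdecomposable_gindec[q [r [q0 r0 iq ep]]] /asboolP sp /eqP lp].
  rewrite ep in sp; have [sq sr] := separable_gsum_inv sp q0 r0.
  apply/allpairsPdep; exists (plen q), (q, r); rewrite mem_index_iota -lp ep plen_gsum.
  split=> //; first by rewrite ltnS leq_addr.
  apply/allpairsP; exists (q, r); rewrite mem_filter iq !mem_seps -lp ep plen_gsum addKn !eqxx.
  by split=> //=; rewrite andbT; apply/asboolP.
move=> /allpairsPdep[i [x []]]; rewrite mem_index_iota ltnS => le_im.
case/allpairsP => -[q r] /= []; rewrite mem_filter !mem_seps.
move=> /and3P[iq /asboolP sq /eqP lq] /andP[/asboolP sr /eqP lr] -> -> /=.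
rewrite plen_gsum lq lr subnKC // eqxx andbT; apply/andP; split.
  by apply/gdecomposableP; exists q, r; rewrite !separable_plen.
by apply/asboolP; exact: separable_gsum.
Qed.

Lemma popularityE s m :
  popularity s (separables m) = \sum_(p <- seps m) nu (word s) (word p).
Proof.
rewrite /popularity big_map big_enum; apply: eq_bigr => p _.
by rewrite occurrencesE /mkperm taggedK.
Qed.

Lemma seps0 : seps 0 = [::].
Proof.
case E : (seps 0) => [//|p s]; have : p \in seps 0 by rewrite E mem_head.
by rewrite mem_seps => /andP[/asboolP/separable_plen + /eqP p0]; rewrite p0.
Qed.

Lemma separable_decomposable p : separable p -> 1 < plen p -> exists b, gdecomposable b p.
Proof.
case=> [//|q r sq sr _|q r sq sr _]; [exists true|exists false];
  by exists q, r; rewrite !separable_plen.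
Qed.

(** The last operation of a derivation provides a decomposition with one sign, and [gindec_excl]
    excludes the other sign. *)
Lemma separable_gindecE b p : separable p -> 1 < plen p ->
  gindec b (word p) = ~~ gindec (~~ b) (word p).
Proof.
move=> sp /(separable_decomposable sp)[b' /gdecomposableP d].
have := gindec_excl d; have [->|nb] := eqVneq b b'.
  by move=> ->; rewrite (negPf d).
have -> : b' = ~~ b by case: (b) (b') nb => -[].
by rewrite negbK => ->; have -> : ~~ b = b' by case: (b) (b') nb => -[].
Qed.

Import Order.TTheory GRing.Theory Num.Theory.
Local Open Scope ring_scope.

(** * Formal power series *)

Definition fps := nat -> int.

HB.instance Definition _ := GRing.Zmodule.copy fps (nat -> int).

(** A coefficient of a product involves only coefficients of at most the same degree, so truncation
    lets associativity and commutativity pass from polynomials to series. *)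
Definition trunc N (f : fps) : {poly int} := \poly_(i < N) f i.

Definition fps_mul (f g : fps) : fps := fun n => \sum_(i < n.+1) f i * g (n - i)%N.
Definition fps_one : fps := fun n => (n == 0%N)%:R.

Lemma fps_mulE N f g n : (n < N)%N -> fps_mul f g n = (trunc N f * trunc N g)`_n.
Proof.
move=> lt_n; rewrite coefM; apply: eq_bigr => i _.
by rewrite !coef_poly !(leq_ltn_trans _ lt_n) // ?leq_subr // -ltnS.
Qed.

Lemma coef_trunc N f n : (n < N)%N -> (trunc N f)`_n = f n.
Proof. by move=> lt_n; rewrite coef_poly lt_n. Qed.

Lemma eq_coefM (p q r s : {poly int}) n :
  (forall i, (i <= n)%N -> p`_i = q`_i) -> (forall i, (i <= n)%N -> r`_i = s`_i) ->
  (p * r)`_n = (q * s)`_n.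
Proof.
move=> epq ers; rewrite !coefM; apply: eq_bigr => i _.
by rewrite epq ?ers ?leq_subr // -ltnS.
Qed.

Lemma fps_mulA : associative fps_mul.
Proof.
move=> f g h; apply/funext => n; rewrite !(@fps_mulE n.+1) //.
transitivity ((trunc n.+1 f * (trunc n.+1 g * trunc n.+1 h))`_n).
  by apply: eq_coefM => // i le_i; rewrite coef_trunc // (@fps_mulE n.+1).
by rewrite mulrA; apply: eq_coefM => // i le_i; rewrite coef_trunc // (@fps_mulE n.+1).
Qed.

Lemma fps_mulC : commutative fps_mul.
Proof. by move=> f g; apply/funext => n; rewrite !(@fps_mulE n.+1) // mulrC. Qed.

Lemma fps_mul1 : left_id fps_one fps_mul.
Proof.
move=> f; apply/funext => n; rewrite /fps_mul big_ord_recl /= mul1r subn0.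
by rewrite big1 ?addr0 // => i _; rewrite mul0r.
Qed.

Lemma fps_mulDl : left_distributive fps_mul +%R.
Proof.
move=> f g h; apply/funext => n; rewrite /fps_mul.
by rewrite -[RHS]big_split /=; apply: eq_bigr => i _; rewrite mulrDl.
Qed.

Lemma fps_one_neq0 : fps_one != 0 :> fps.
Proof. by apply/eqP => /(congr1 (fun f : fps => f 0%N)). Qed.

HB.instance Definition _ := GRing.Zmodule_isComNzRing.Build fps
  fps_mulA fps_mulC fps_mul1 fps_mulDl fps_one_neq0.

Lemma fpsM (f g : fps) n : (f * g) n = \sum_(i < n.+1) f i * g (n - i)%N.
Proof. by []. Qed.

Lemma fpsD (f g : fps) n : (f + g) n = f n + g n. Proof. by []. Qed.

Lemma fps_sum I (r : seq I) P (F : I -> fps) n :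
  (\sum_(i <- r | P i) F i) n = \sum_(i <- r | P i) F i n.
Proof. exact: (big_morph (fun f : fps => f n)). Qed.

Definition const_term (f : fps) : int := f 0%N.

Lemma const_term_is_additive : zmod_morphism const_term.
Proof. by []. Qed.
HB.instance Definition _ := GRing.isZmodMorphism.Build fps int const_term const_term_is_additive.

Lemma const_term_is_multiplicative : monoid_morphism const_term.
Proof. by split=> // f g; rewrite /const_term fpsM big_ord1. Qed.
HB.instance Definition _ :=
  GRing.isMonoidMorphism.Build fps int const_term const_term_is_multiplicative.

Lemma const_termD f g : const_term (f + g) = const_term f + const_term g.
Proof. by []. Qed.

Lemma const_termM f g : const_term (f * g) = const_term f * const_term g.
Proof. exact: (rmorphM const_term). Qed.

Lemma const_termX f n : const_term (f ^+ n) = const_term f ^+ n.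
Proof. exact: (rmorphXn const_term). Qed.

Lemma const_term_int (c : int) : const_term c%:~R = c.
Proof. by rewrite (rmorph_int const_term) intz. Qed.

Lemma fps_neq0P (f : fps) : f != 0 -> exists2 i, f i != 0 & forall j, (j < i)%N -> f j = 0.
Proof.
move=> f0; have ex : exists i, f i != 0.
  apply: contrapT => h; case/eqP: f0; apply/funext => i.
  by apply: contrapT => /eqP fi; apply: h; exists i.
exists (ex_minn ex); case: ex_minnP => // m _ min j lt_j.
by apply/eqP; apply: contraLR lt_j => /min; rewrite -leqNgt.
Qed.

(** The lowest nonzero coefficients, at [i] and [j], would multiply to the coefficient of the
    product at [i + j], all other terms there being zero. *)
Lemma fps_mulf_eq0 (f g : fps) : f * g = 0 -> f != 0 -> g = 0.
Proof.
move=> fg /fps_neq0P[i fi minf]; apply/eqP; apply: contraT => /fps_neq0P[j gj ming].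
have := congr1 (fun h : fps => h (i + j)%N) fg.
have lt_i : (i < (i + j).+1)%N by rewrite ltnS leq_addr.
rewrite fpsM (bigD1 (Ordinal lt_i)) //= addKn big1 => [|k ne].
  by rewrite addr0 => /eqP; rewrite mulf_eq0 (negPf fi) (negPf gj).
have ne_k : (k : nat) != i by apply: contraNneq ne => e; apply/eqP/val_inj.
case: (ltngtP k i) ne_k => // cmp _; first by rewrite minf ?mul0r.
by rewrite ming ?mulr0 // ltn_subLR ?ltn_add2r // -ltnS.
Qed.

Lemma fps_mulfI (f : fps) : f != 0 -> injective ( *%R f).
Proof.
move=> f0 g h e; apply/eqP; rewrite -subr_eq0; apply/eqP.
by apply: (fps_mulf_eq0 _ f0); rewrite mulrBr e subrr.
Qed.

Lemma const_term_neq0 (f : fps) : const_term f != 0 -> f != 0.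
Proof. by apply: contraNneq => ->; rewrite raddf0. Qed.

Lemma fps_expf_neq0 (f : fps) n : f != 0 -> f ^+ n != 0.
Proof.
move=> f0; elim: n => [|n IH]; first by rewrite expr0 oner_neq0.
by rewrite exprS; apply: contra_neq IH => e; exact: fps_mulf_eq0 e f0.
Qed.

(** * Substitution of a power series into integer polynomials *)

Definition ev (D : fps) (p : {poly int}) : fps := (map_poly intr p).[D].

Lemma evM D p q : ev D (p * q) = ev D p * ev D q.
Proof. by rewrite /ev rmorphM hornerM. Qed.
Lemma evD D p q : ev D (p + q) = ev D p + ev D q.
Proof. by rewrite /ev rmorphD hornerD. Qed.
Lemma ev1 D : ev D 1 = 1.
Proof. by rewrite /ev rmorph1 hornerC. Qed.
Lemma ev0 D : ev D 0 = 0.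
Proof. by rewrite /ev rmorph0 hornerC. Qed.
Lemma evX D : ev D 'X = D.
Proof. by rewrite /ev map_polyX hornerX. Qed.
Lemma evN D p : ev D (- p) = - ev D p.
Proof. by rewrite /ev rmorphN hornerN. Qed.
Lemma ev_sum D I (r : seq I) P F :
  ev D (\sum_(i <- r | P i) F i) = \sum_(i <- r | P i) ev D (F i).
Proof. by apply: (big_morph (ev D)); [exact: evD|exact: ev0]. Qed.
Lemma ev_prod D I (r : seq I) P F :
  ev D (\prod_(i <- r | P i) F i) = \prod_(i <- r | P i) ev D (F i).
Proof. by apply: (big_morph (ev D)); [exact: evM|exact: ev1]. Qed.

Lemma const_term_ev D p : const_term D = 0 -> const_term (ev D p) = p.[0].
Proof.
move=> D0; elim/poly_ind: p => [|p c IH]; first by rewrite ev0 raddf0 horner0.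
rewrite evD evM evX const_termD const_termM D0 mulr0 add0r hornerMXaddC mulr0 add0r.
by rewrite /ev map_polyC hornerC const_term_int.
Qed.

(** This is the transcendence of such a series over the integers. If r(D) D + c = 0, the constant
    term gives c = 0; then D cancels and the degree has dropped. *)
Lemma ev_inj D : D != 0 -> const_term D = 0 -> injective (ev D).
Proof.
move=> D0 cD p q e; apply/eqP; rewrite -subr_eq0; apply/eqP.
have {e} : ev D (p - q) = 0 by rewrite evD evN e subrr.
elim/poly_ind: (p - q) => // r c IH; rewrite evD evM evX.
have -> : ev D c%:P = c%:~R by rewrite /ev map_polyC hornerC.
move=> e; have c0 : c = 0.
  by have := congr1 const_term e; rewrite const_termD const_termM cD mulr0 add0r const_term_int.
rewrite c0 mulr0z addr0 in e *.
by rewrite IH ?mul0r ?add0r ?c0 //; apply: (fps_mulf_eq0 _ D0); rewrite mulrC.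
Qed.

(** * Narayana polynomials *)

(* [nar k] is N_k; the list [nars n] of N_0, ..., N_n makes the convolution
   recurrence structural. *)
Fixpoint nars n : seq {poly int} :=
  if n is n'.+1 then
    rcons (nars n') (\sum_(i < n'.+1)
      (if i == 0%N :> nat then 1 else 'X) * (nars n')`_i * (nars n')`_(n' - i))
  else [:: 1].

Definition nar n := (nars n)`_n.

Lemma size_nars n : size (nars n) = n.+1.
Proof. by elim: n => //= n IH; rewrite size_rcons IH. Qed.

Lemma nth_nars n i : (i <= n)%N -> (nars n)`_i = nar i.
Proof.
elim: n => [|n IH]; first by case: i.
rewrite leq_eqVlt => /orP[/eqP -> //|lt_i].
by rewrite /= nth_rcons size_nars lt_i IH.
Qed.

Lemma nar0 : nar 0 = 1. Proof. by []. Qed.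

Lemma narS n : nar n.+1 =
  \sum_(i < n.+1) (if i == 0%N :> nat then 1 else 'X) * nar i * nar (n - i).
Proof.
rewrite /nar /= nth_rcons size_nars ltnn eqxx; apply: eq_bigr => i _.
by rewrite !nth_nars ?leq_subr // -ltnS.
Qed.

Lemma nar1 : nar 1 = 1.
Proof. by rewrite narS big_ord1 /= !mul1r. Qed.

Lemma nar2 : nar 2 = 1 + 'X.
Proof. by rewrite narS !big_ord_recl big_ord0 /= /bump /= !subn0 subnn nar1 nar0 !mulr1 addr0. Qed.

Lemma horner0_nar n : (nar n).[0] = 1.
Proof.
elim/ltn_ind: n => -[|n] IH; first by rewrite nar0 hornerE.
rewrite narS horner_sum big_ord_recl /= subn0 !hornerM !IH // hornerE !mul1r.
by rewrite big1 ?addr0 // => i _; rewrite !hornerM hornerX !mul0r.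
Qed.

Lemma nar_neq0 n : nar n != 0.
Proof. by apply/eqP => e; have := horner0_nar n; rewrite e horner0. Qed.

(** * Real roots of the Narayana polynomials *)

Section Roots.
Variable R : rcfType.

Definition rnar n : {poly R} := map_poly intr (nar n).

Lemma rnarS n (y : R) : (rnar n.+1).[y] =
  \sum_(i < n.+1) (if i == 0%N :> nat then 1 else y) * (rnar i).[y] * (rnar (n - i)).[y].
Proof.
rewrite /rnar narS rmorph_sum horner_sum; apply: eq_bigr => i _.
rewrite !rmorphM !hornerM; congr (_ * _ * _).
by case: ifP => _ /=; [rewrite rmorph1 hornerE|rewrite map_polyX hornerX].
Qed.

Lemma rnar_horner0 n : (rnar n).[0] = 1.
Proof. by have := horner_map (intr : int -> R) (nar n) 0; rewrite rmorph0 horner0_nar. Qed.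

(* At the largest root [d < 0] of [nar k], all terms of the recurrence for
   [nar k.+1] vanish or are negative; since [nar k.+1] is [1] at [0], it has a
   root in [(d, 0)]. *)
Lemma rnar_largest_root k : (2 <= k)%N ->
  exists d : R, [/\ d < 0, (rnar k).[d] = 0,
    forall j, (j < k)%N -> 0 < (rnar j).[d] &
    forall y j, d < y <= 0 -> (j <= k)%N -> 0 < (rnar j).[y]].
Proof.
elim: k => // k IH; rewrite leq_eqVlt => /orP[/eqP <-|].
  have n0 : rnar 0 = 1 by rewrite /rnar nar0 rmorph1.
  have n1 : rnar 1 = 1 by rewrite /rnar nar1 rmorph1.
  have n2 y : (rnar 2).[y] = 1 + y.
    by rewrite /rnar nar2 rmorphD /= rmorph1 map_polyX !hornerE.
  exists (-1); split; first lra.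
  - rewrite n2; lra.
  - by case=> [|[|]] // _; rewrite ?n0 ?n1 hornerE ltr01.
  - move=> y [|[|[|]]] // hy _; rewrite ?n2 ?n0 ?n1 ?hornerE; lra.
rewrite ltnS => k2; have [d [d0 dk dj dy]] := IH k2.
have neg : (rnar k.+1).[d] < 0.
  case: k k2 dk dj {dy IH} => [|[|k]] // _ dk dj.
  (* The two extreme terms contain the polynomial that vanishes at [d]. At least one middle term
     remains, and each middle term is [d < 0] times two positive values. *)
  rewrite rnarS big_ord_recl /= subn0 dk mulr0 add0r big_ord_recr /=.
  rewrite [X in _ * X * _]dk mulr0 mul0r addr0 big_ord_recl /=.
  have term i : (0 < i < k.+2)%N -> d * (rnar i).[d] * (rnar (k.+2 - i)).[d] < 0.
    move=> /andP[i0 ik]; rewrite pmulr_llt0 ?nmulr_rlt0 //; apply: dj => //.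
    by rewrite ltn_subrL i0.
  rewrite -[X in _ < X]addr0 ltr_leD ?term //; apply: sumr_le0 => i _.
  by apply/ltW/term; rewrite /bump /= !add1n !ltnS ?ltn_ord.
have p0 : rnar k.+1 != 0 by apply/eqP => e; rewrite e horner0 ltxx in neg.
have [x0 x0in rx0] : {x | x \in `]d, 0[ & root (rnar k.+1) x}.
  by apply: poly_ivtoo; rewrite ?ltW // rnar_horner0 mulr1.
have : x0 \in roots (rnar k.+1) d 0 by rewrite in_roots rx0 x0in.
(* The list of roots is sorted, so its last entry [x] is the largest root in the interval and none
   lies strictly between [x] and 0. *)
case/lastP E : (roots _ d 0) => [//|s x] _.
have := eqxx (roots (rnar k.+1) d 0); rewrite {2}E roots_rcons.
case/and5P => _; rewrite in_itv /= => /andP[dx x_0] /eqP nor rx _.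
have pos y : x < y <= 0 -> 0 < (rnar k.+1).[y].
  move=> /andP[xy y0]; rewrite ltNge; apply/negP => ny.
  have [z + rz] : {z | z \in `[y, 0] & root (rnar k.+1) z}.
    by apply: polyrcf.poly_ivt => //; rewrite rnar_horner0 mulr1.
  rewrite in_itv /= => /andP[yz z0]; have z_lt0 : z < 0.
    rewrite lt_neqAle z0 andbT; apply: contraTneq rz => ->.
    by rewrite /root rnar_horner0 oner_eq0.
  have := roots_nil p0 nor; move=> /(_ z).
  by rewrite rz in_itv /= (lt_le_trans xy yz) z_lt0 => /(_ isT).
exists x; split=> //; first exact/eqP.
- by move=> j jk; apply: dy => //; rewrite dx ltW.
- move=> y j /andP[xy y0]; rewrite leq_eqVlt => /orP[/eqP ->|jk].
    by apply: pos; rewrite xy.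
  by apply: dy => //; rewrite (lt_trans dx xy).
Qed.
End Roots.

Lemma bigmax_mem (s : seq nat) : s != [::] -> \max_(k <- s) k \in s.
Proof.
elim: s => // x [|y s] IH _; first by rewrite big_seq1 mem_head.
rewrite big_cons; case: (leqP x (\max_(k <- y :: s) k)) => _; last exact: mem_head.
by rewrite inE IH // orbT.
Qed.

(** Let M >= 2 be the largest entry of both lists and d the largest root of N_M. As N_j is positive
    at d for j < M, a product vanishes at d exactly when M is in its list. So M occurs in both
    lists, can be removed from both, and induction applies. *)
Lemma nar_indep (l l' : seq nat) : 0%N \notin l -> 0%N \notin l' -> sumn l = sumn l' ->
  \prod_(k <- l) nar k = \prod_(k <- l') nar k -> perm_eq l l'.
Proof.
have [n] := ubnP (size l); elim: n l l' => // n IH l l' lt_n l0 l'0 es ep.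
have nz (r : seq nat) : \prod_(k <- r) nar k != 0.
  by rewrite prodf_seq_neq0; apply/allP => k _ /=; exact: nar_neq0.
pose M := \max_(k <- l ++ l') k.
have maxM k : k \in l ++ l' -> (k <= M)%N by move=> kl; exact: leq_bigmax_seq.
(* If all entries are 1, the product carries no information since N_1 = 1, but the sum gives the
   number of entries. *)
case: (leqP M 1) => [M1|M2].
  have nseq1 (r : seq nat) : 0%N \notin r -> {subset r <= l ++ l'} -> r = nseq (sumn r) 1%N.
    elim: r => //= x r IHr; rewrite inE negb_or => /andP[x0 r0] sub.
    have x1 : x = 1%N.
      have := leq_trans (maxM x (sub x (mem_head _ _))) M1.
      by case: x x0 {sub IHr} => [|[]].
    by rewrite {1}(IHr r0) ?x1 // => y yr; apply: sub; rewrite inE yr orbT.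
  have ll : l = nseq (sumn l) 1%N by apply: nseq1 => // x xl; rewrite mem_cat xl.
  have ll' : l' = nseq (sumn l') 1%N by apply: nseq1 => // x xl; rewrite mem_cat xl orbT.
  by rewrite ll ll' es.
have [d [_ dM dj _]] := rnar_largest_root realalg M2.
have vanish (r : seq nat) : {subset r <= l ++ l'} ->
    (map_poly (intr : int -> realalg) (\prod_(k <- r) nar k)).[d] == 0 -> M \in r.
  move=> sub; rewrite rmorph_prod horner_prod prodf_seq_eq0 => /hasP[k kr /= /eqP e].
  have := maxM k (sub k kr); rewrite leq_eqVlt => /orP[/eqP <- //|/dj].
  by rewrite e ltxx.
have vanish' (r : seq nat) : M \in r ->
    (map_poly (intr : int -> realalg) (\prod_(k <- r) nar k)).[d] == 0.
  move=> Mr; rewrite rmorph_prod horner_prod prodf_seq_eq0; apply/hasP.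
  by exists M => //=; apply/eqP.
have subl : {subset l <= l ++ l'} by move=> x xl; rewrite mem_cat xl.
have subl' : {subset l' <= l ++ l'} by move=> x xl; rewrite mem_cat xl orbT.
have [Ml Ml'] : M \in l /\ M \in l'.
  have [|] : M \in l \/ M \in l'.
    have : M \in l ++ l'.
      by apply: bigmax_mem; apply: contraTneq M2 => e; rewrite /M e big_nil.
    by rewrite mem_cat => /orP.
  - by move=> Ml; split=> //; apply: vanish subl' _; rewrite -ep; exact: vanish'.
  - by move=> Ml; split=> //; apply: vanish subl _; rewrite ep; exact: vanish'.
have [pl pl'] := (perm_to_rem Ml, perm_to_rem Ml').
rewrite (perm_trans pl) // perm_sym (perm_trans pl') // perm_cons perm_sym.
apply: IH.
- by rewrite size_rem //; case: (l) Ml lt_n.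
- by apply: contra l0; exact: mem_rem.
- by apply: contra l'0; exact: mem_rem.
- by move: es; rewrite (perm_sumn pl) (perm_sumn pl') /= => /addnI.
- by move: ep; rewrite (perm_big _ pl) (perm_big _ pl') !big_cons; apply/mulfI/nar_neq0.
Qed.

(** * Popularity generating functions *)

Definition gf (phi : permutation -> nat) (C : pred permutation) : fps :=
  fun m => (\sum_(p <- seps m | C p) phi p)%N%:R.

(** The empty pattern occurs exactly once in every permutation, so for [v = [::]] these series count
    permutations by length. *)
Definition pop_gf v := gf (fun p => nu v (word p)) predT.
Definition indec_gf b v := gf (fun p => nu v (word p)) (fun p => gindec b (word p)).
Definition dec_gf b v := gf (fun p => nu v (word p)) (fun p => ~~ gindec b (word p)).

Lemma pop_gf_split b v : pop_gf v = indec_gf b v + dec_gf b v.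
Proof. by apply/funext => m; rewrite fpsD /pop_gf /gf (bigID (fun p => gindec b (word p))) natrD. Qed.

(** The first component is cut off the permutation and the pattern is cut accordingly; the sum over
    the length of that component becomes a product of series. *)
Lemma dec_gf_conv b v :
  dec_gf b v = \sum_(j < (size v).+1 | cut b v j) indec_gf b (take j v) * pop_gf (drop j v).
Proof.
apply/funext => m; rewrite fps_sum /dec_gf /gf sum_decomposables natr_sum.
under [RHS]eq_bigr => j _ do rewrite fpsM.
rewrite [RHS]exchange_big /=; apply: eq_bigr => i _.
under eq_bigr => q _ do under eq_bigr => r _ do rewrite nu_gsum.
under eq_bigr => q _ do rewrite exchange_big.
rewrite exchange_big natr_sum; apply: eq_bigr => j _ /=.
rewrite -natrM big_distrl /=; congr _%:R; apply: eq_bigr => q _.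
by rewrite big_distrr.
Qed.

(** Indecomposable for one sign means decomposable for the other, except for the permutation of
    length one, in which [v] is too long to occur. *)
Lemma indec_gf_flip b v : (1 < size v)%N -> indec_gf b v = dec_gf (~~ b) v.
Proof.
move=> v1; apply/funext => m; rewrite /indec_gf /dec_gf /gf; congr _%:R.
rewrite big_mkcond [RHS]big_mkcond; apply: eq_big_seq => p.
rewrite mem_seps => /andP[/asboolP sp _]; case: (leqP (plen p) 1) => [le1|gt1].
  by rewrite nu_small ?if_same // size_word (leq_ltn_trans le1).
by rewrite (separable_gindecE b sp gt1).
Qed.

(* With S and Q the generating functions of all and of the indecomposable
   separable permutations, (1 + S)(1 - Q) = 1; so [DQ] is D = 1 / (1 - Q)^2 - 1. *)
Definition one_plus_S : fps := 1 + pop_gf [::].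
Definition one_minus_Q : fps := 1 - indec_gf true [::].
Definition DQ : fps := one_plus_S ^+ 2 - 1.
Definition one_minus_D : fps := 1 - DQ.
Definition point_gf : fps := pop_gf [:: 0%N].

Lemma pop_gf_nil b : pop_gf [::] = indec_gf b [::] + indec_gf b [::] * pop_gf [::].
Proof. by rewrite {1}(pop_gf_split b) dec_gf_conv big_mkcond big_ord1. Qed.

Lemma indec_gf_nil_inv b : (1 - indec_gf b [::]) * one_plus_S = 1.
Proof.
rewrite /one_plus_S;
transitivity (1 + (pop_gf [::] - (indec_gf b [::] + indec_gf b [::] * pop_gf [::]))); first by ring.
by rewrite -pop_gf_nil subrr addr0.
Qed.

Lemma one_minus_QK : one_minus_Q * one_plus_S = 1. Proof. exact: indec_gf_nil_inv. Qed.

(** For each sign, 1 minus the series is the inverse of the same [one_plus_S], so both signs share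
    the series Q. *)
Lemma indec_gf_nil b : indec_gf b [::] = 1 - one_minus_Q.
Proof.
have := congr1 (fun x => x * one_minus_Q) (indec_gf_nil_inv b).
by rewrite -mulrA [one_plus_S * one_minus_Q]mulrC one_minus_QK mulr1 mul1r => <-; ring.
Qed.

Lemma cut_gindec b v j : gindec b v -> (0 < j < size v)%N -> cut b v j = false.
Proof.
move=> iv /andP[j0 jv]; apply: contraTF iv => cj; apply/gindecP; by exists j.
Qed.

Lemma sum_cut_gindec (M : nmodType) b v (phi : nat -> M) : (0 < size v)%N -> gindec b v ->
  \sum_(j < (size v).+1 | cut b v j) phi j = phi 0%N + phi (size v).
Proof.
move=> v0 iv; rewrite big_mkcond big_ord_recl /= cut0; congr (_ + _).
case E : (size v) v0 => [//|n] _; rewrite big_ord_recr /= big1 ?add0r => [|i _].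
  by rewrite /bump /= add1n -E cut_oversize.
by rewrite cut_gindec // E /bump /= add1n ltnS ltn_ord.
Qed.

(** An indecomposable pattern occurs wholly in the first component or wholly in the rest. Writing F
    for [pop_gf v] and I for [indec_gf b v], this gives F = I + Q F + I S, and 1 + S inverts 1 -
    Q. *)
Lemma pop_gf_gindec b v : (0 < size v)%N -> gindec b v -> pop_gf v = one_plus_S ^+ 2 * indec_gf b v.
Proof.
move=> v0 iv; have : (1 - indec_gf b [::]) * pop_gf v = indec_gf b v * one_plus_S.
  have : pop_gf v = indec_gf b v + (indec_gf b [::] * pop_gf v + indec_gf b v * pop_gf [::]).
    rewrite {1}(pop_gf_split b) dec_gf_conv
      (sum_cut_gindec (fun j => indec_gf b (take j v) * pop_gf (drop j v))) //.
    by rewrite take0 drop0 take_size drop_size.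
  move=> h; rewrite mulrBl mul1r {1}h /one_plus_S; ring.
by move=> /(congr1 (fun x => x * one_plus_S)); rewrite mulrAC indec_gf_nil_inv mul1r => ->; ring.
Qed.

Lemma pop_gf_dec b v : (1 < size v)%N -> ~~ gindec b v -> pop_gf v = one_plus_S ^+ 2 * dec_gf b v.
Proof.
move=> v1 dv; have := indec_gf_flip (~~ b) v1; rewrite negbK => <-.
by apply: pop_gf_gindec; [exact: ltnW|exact: gindec_excl].
Qed.

(** With F = [pop_gf v], the indecomposable part is F minus [dec_gf b v], and (1 + S)^2 times the
    latter is F; the remaining factor of F is (1 + S)^2 - 1 = D. *)
Lemma indec_gf_dec b v : (1 < size v)%N -> ~~ gindec b v -> one_plus_S ^+ 2 * indec_gf b v = DQ * pop_gf v.
Proof.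
move=> v1 dv; have := pop_gf_dec v1 dv; have := pop_gf_split b v; rewrite /DQ => eF eB.
have -> : indec_gf b v = pop_gf v - dec_gf b v by rewrite eF addrK.
by rewrite mulrBr -eB; ring.
Qed.

(** * Patterns with several components *)

Definition bsum b (ps : seq permutation) := \big[gsum b/empty_perm]_(p <- ps) p.

Lemma bsum_cons b p ps : bsum b (p :: ps) = gsum b p (bsum b ps).
Proof. by rewrite /bsum big_cons. Qed.

Lemma bsum_cat b ps qs : bsum b (ps ++ qs) = gsum b (bsum b ps) (bsum b qs).
Proof. by rewrite /bsum big_cat. Qed.

Lemma bsum1 b p : bsum b [:: p] = p.
Proof. by rewrite /bsum big_seq1. Qed.

Lemma plen_bsum b ps : plen (bsum b ps) = sumn (map plen ps).
Proof. by elim: ps => [|p ps IH]; rewrite ?bsum_cons ?plen_gsum ?IH // /bsum big_nil. Qed.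

Lemma take_word_gsum b p q :
  exists k, take (plen p) (word (gsum b p q)) = [seq (k + x)%N | x <- word p].
Proof.
rewrite word_gsum; case: b; [exists 0%N|exists (plen q)]; rewrite take_size_cat ?size_map ?size_word //.
by rewrite map_id_in.
Qed.

Lemma drop_word_gsum b p q :
  exists k, drop (plen p) (word (gsum b p q)) = [seq (k + x)%N | x <- word q].
Proof.
rewrite word_gsum; case: b; [exists (plen p)|exists 0%N]; rewrite drop_size_cat ?size_map ?size_word //.
by rewrite map_id_in.
Qed.

Lemma pop_gf_shift k v : pop_gf [seq (k + x)%N | x <- v] = pop_gf v.
Proof. by apply/funext => m; congr _%:R; apply: eq_bigr => p _; rewrite nu_shiftl. Qed.

Lemma indec_gf_shift b k v : indec_gf b [seq (k + x)%N | x <- v] = indec_gf b v.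
Proof. by apply/funext => m; congr _%:R; apply: eq_bigr => p _; rewrite nu_shiftl. Qed.

(** The cuts of an iterated sum of indecomposables are exactly the boundaries between components,
    that is, the lengths of the partial sums. *)
Lemma sum_cut_bsum (M : nmodType) b ps (phi : nat -> M) :
  (forall p, p \in ps -> (0 < plen p)%N /\ gindec b (word p)) ->
  \sum_(j < (plen (bsum b ps)).+1 | cut b (word (bsum b ps)) j) phi j =
  \sum_(i < (size ps).+1) phi (plen (bsum b (take i ps))).
Proof.
elim: ps phi => [|p ps IH] phi hps.
  by rewrite /bsum big_nil big_mkcond !big_ord1 cut0.
have [p0 ip] := hps p (mem_head _ _).
rewrite [RHS]big_ord_recl [bsum b (take ord0 _)]big_nil.
rewrite [X in _ = _ + X](eq_bigr (fun i : 'I_(size ps).+1 =>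
  phi (plen p + plen (bsum b (take i ps)))%N)); last first.
  by move=> i _; rewrite /= bsum_cons plen_gsum.
rewrite -(IH (fun j => phi (plen p + j)%N)) => [|q qps]; last first.
  by apply: hps; rewrite inE qps orbT.
rewrite bsum_cons plen_gsum -addnS -(big_mkord (cut b _) phi).
(* Below [plen p] only the cut at 0 exists, as [p] is indecomposable; from there on the cuts are
   those of the remaining sum, shifted. *)
rewrite (big_cat_nat _ _ (n := plen p)) ?leq_addr //=; congr (_ + _).
  rewrite big_mkord -(prednK p0) big_mkcond big_ord_recl /= cut0 big1 ?addr0 // => i _.
  have lt_i : (i.+1 < plen p)%N by rewrite -ltn_predRL ltn_ord.
  by rewrite /bump /= add1n cut_gsum_le ?cut_gindec ?size_word // ltnW.
rewrite -{1}[plen p]add0n big_addn addKn big_mkord.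
apply: eq_big => [j|j _]; last by rewrite addnC.
by rewrite cut_gsum_ge ?leq_addl // addnK.
Qed.

Definition comps b (ps : seq permutation) :=
  forall p, p \in ps -> (0 < plen p)%N /\ gindec b (word p).

Lemma comps_take b n ps : comps b ps -> comps b (take n ps).
Proof. by move=> h p /mem_take; exact: h. Qed.

Lemma comps_drop b n ps : comps b ps -> comps b (drop n ps).
Proof. by move=> h p /mem_drop; exact: h. Qed.

Lemma bsum_gt0 b ps : comps b ps -> (0 < size ps)%N -> (0 < plen (bsum b ps))%N.
Proof.
case: ps => // p ps h _; rewrite bsum_cons plen_gsum addn_gt0.
by have [-> _] := h p (mem_head _ _).
Qed.

Lemma bsum_dec b ps : comps b ps -> (1 < size ps)%N -> ~~ gindec b (word (bsum b ps)).
Proof.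
case: ps => // p ps h s1; apply/gdecomposableP; exists p, (bsum b ps); rewrite bsum_cons.
split=> //; first by have [] := h p (mem_head _ _).
by apply: bsum_gt0 => // q qps; apply: h; rewrite inE qps orbT.
Qed.

Lemma bsum_gt1 b ps : comps b ps -> (1 < size ps)%N -> (1 < plen (bsum b ps))%N.
Proof.
case: ps => // p ps h s1; rewrite bsum_cons plen_gsum.
have [p0 _] := h p (mem_head _ _).
have /(bsum_gt0) : comps b ps by move=> q qps; apply: h; rewrite inE qps orbT.
by move=> /(_ s1); move: (plen _) (plen _) p0 => m n; lia.
Qed.

Lemma dec_gf_bsum b ps : comps b ps ->
  dec_gf b (word (bsum b ps)) =
  \sum_(i < (size ps).+1) indec_gf b (word (bsum b (take i ps))) * pop_gf (word (bsum b (drop i ps))).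
Proof.
move=> h; rewrite dec_gf_conv size_word.
rewrite (sum_cut_bsum (fun j => indec_gf b (take j (word _)) * pop_gf (drop j (word _)))) //.
apply: eq_bigr => i _.
have -> : bsum b ps = gsum b (bsum b (take i ps)) (bsum b (drop i ps)).
  by rewrite -bsum_cat cat_take_drop.
have [k ->] := take_word_gsum b (bsum b (take i ps)) (bsum b (drop i ps)).
have [l ->] := drop_word_gsum b (bsum b (take i ps)) (bsum b (drop i ps)).
by rewrite indec_gf_shift pop_gf_shift.
Qed.

(** In the convolution for the series F of the whole pattern, the end terms are Q F and I S, with I
    the series over indecomposable permutations; the inner terms cut between two components.
    Eliminating I by (1 + S)^2 I = D F and solving for F gives the formula. *)
Lemma pop_gf_bsum b ps k : comps b ps -> size ps = k.+2 ->
  one_minus_D * pop_gf (word (bsum b ps)) =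
  one_minus_Q * \sum_(i < k.+1) (if i == 0%N :> nat then 1 else DQ) *
        pop_gf (word (bsum b (take i.+1 ps))) * pop_gf (word (bsum b (drop i.+1 ps))).
Proof.
move=> h sz; have s1 : (1 < size ps)%N by rewrite sz.
have w1 : (1 < size (word (bsum b ps)))%N by rewrite size_word bsum_gt1.
have dps := bsum_dec h s1.
have := dec_gf_bsum h; rewrite sz big_ord_recl big_ord_recr /= take0 drop0.
set Sig := \sum_(i < _) _.
rewrite /bump /= add1n -sz take_size drop_size [bsum b [::]]big_nil word_empty indec_gf_nil.
set Fv := pop_gf (word _) => eB.
have eF : Fv = one_plus_S ^+ 2 * dec_gf b (word (bsum b ps)) by exact: pop_gf_dec.
have eA : one_plus_S ^+ 2 * indec_gf b (word (bsum b ps)) = DQ * Fv by exact: indec_gf_dec.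
have eSig : one_plus_S ^+ 2 * Sig = \sum_(i < k.+1) (if i == 0%N :> nat then 1 else DQ) *
        pop_gf (word (bsum b (take i.+1 ps))) * pop_gf (word (bsum b (drop i.+1 ps))).
  rewrite /Sig big_distrr; apply: eq_bigr => i _; rewrite /= /bump /= add1n mulrA; congr (_ * _).
  have lt_i : (i.+1 < size ps)%N by rewrite sz ltnS ltn_ord.
  have st : size (take i.+1 ps) = i.+1 by rewrite size_takel // ltnW.
  (* For [i = 0] the prefix is a single indecomposable component and gets the factor 1; otherwise it
     is decomposable and gets the factor D. These are the weights in the recurrence of [nar]. *)
  case: ifP => [/eqP i0|/negbT i0].
    rewrite i0 /= mul1r; case: (ps) h lt_i => // p qs h _; rewrite /= take0 bsum1.
    have [p0 ip] := h p (mem_head _ _).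
    by rewrite -pop_gf_gindec // size_word.
  rewrite indec_gf_dec //; last first.
    by apply: bsum_dec; [exact: comps_take|rewrite st ltnS lt0n].
  by rewrite size_word bsum_gt1 ?st ?ltnS ?lt0n //; exact: comps_take.
rewrite -eSig; move: eF; rewrite eB !mulrDr (mulrA _ (indec_gf b _)) eA.
have -> : pop_gf [::] = one_plus_S - 1 by rewrite /one_plus_S addrC addKr.
(* Collecting the terms in F leaves the factor (1 + S)(2 - (1 + S)^2) = (1 + S)(1 - D), and
   [one_minus_Q] cancels 1 + S. *)
rewrite /one_minus_D /DQ => eF;
transitivity (one_minus_Q * (one_plus_S * (2 - one_plus_S ^+ 2) * Fv)).
  by rewrite !mulrA one_minus_QK; ring.
congr (_ * _).
transitivity (Fv - (one_plus_S ^+ 2 - one_plus_S * (one_minus_Q * one_plus_S)) * Fv -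
    (one_plus_S ^+ 2 - 1) * Fv * (one_plus_S - 1)).
  by rewrite one_minus_QK; ring.
by rewrite {1}eF; ring.
Qed.

(** The recurrence for F has the shape of that of [nar]: cutting k + 2 components after the first i
    + 1 calls for [nar i] and [nar (k - i)], and the exponents add up to i + (k - i) + 1. *)
Lemma pop_gf_prod b k ps : comps b ps -> size ps = k.+1 ->
  one_minus_D ^+ k * pop_gf (word (bsum b ps)) =
  one_minus_Q ^+ k * ev DQ (nar k) * \prod_(p <- ps) pop_gf (word p).
Proof.
elim/ltn_ind: k ps => -[|k] IH ps h sz.
  by case: ps sz h => [|p [|]] // _ _; rewrite bsum1 big_seq1 nar0 ev1 !expr0 !mul1r.
rewrite exprSr -mulrA (pop_gf_bsum h sz) narS ev_sum !mulrA !big_distrr !big_distrl /=.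
apply: eq_bigr => i _; rewrite !evM.
have -> : ev DQ (if i == 0%N :> nat then 1 else 'X) = if i == 0%N :> nat then 1 else DQ.
  by case: ifP; rewrite ?ev1 ?evX.
have st : size (take i.+1 ps) = i.+1 by rewrite size_takel // sz ltnS ltnW.
have sd : size (drop i.+1 ps) = (k - i).+1 by rewrite size_drop sz subSS subSn // -ltnS.
have le_i : (i <= k)%N by rewrite -ltnS.
have e1 := IH i (ltn_ord i) _ (comps_take (n:=i.+1) h) st.
have e2 := IH (k - i)%N (leq_ltn_trans (leq_subr _ _) (ltnSn k)) _ (comps_drop (n:=i.+1) h) sd.
rewrite -{3}(cat_take_drop i.+1 ps) big_cat /=.
have expk (x : fps) : x ^+ k = x ^+ i * x ^+ (k - i) by rewrite -exprD subnKC.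
rewrite [one_minus_D ^+ k]expk.
set d := if _ then _ else _.
transitivity (one_minus_Q * d * (one_minus_D ^+ i * pop_gf (word (bsum b (take i.+1 ps)))) *
   (one_minus_D ^+ (k - i) * pop_gf (word (bsum b (drop i.+1 ps))))); first by ring.
by rewrite e1 e2 exprS [one_minus_Q ^+ k]expk; ring.
Qed.

(** * Signatures and generating functions determine each other *)

(** Here [s] stands for the signature of a tree of [p], so [sumn s] is the length minus one; the
    last clause is the closed formula for the generating function. *)
Definition tree_spec (p : permutation) (s : seq nat) :=
  [/\ plen p = (sumn s).+1, 0%N \notin s, separable p &
    one_minus_D ^+ sumn s * pop_gf (word p) =
    one_minus_Q ^+ sumn s * ev DQ (\prod_(k <- s) nar k) * point_gf ^+ (sumn s).+1].

Lemma separable_bsum b ps : (0 < size ps)%N -> {in ps, forall p, separable p} ->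
  separable (bsum b ps).
Proof.
case: ps => // p ps _; elim: ps p => [|q ps IH] p sp.
  by rewrite bsum1; apply: sp; rewrite mem_head.
rewrite bsum_cons; apply: separable_gsum; first by apply: sp; rewrite mem_head.
by apply: IH => r rqs; apply: sp; rewrite inE rqs orbT.
Qed.

Lemma tree_spec_node b ps (sg : permutation -> seq nat) : (1 < size ps)%N ->
  comps b ps -> (forall p, p \in ps -> tree_spec p (sg p)) ->
  tree_spec (bsum b ps) ((size ps).-1 :: flatten [seq sg p | p <- ps]).
Proof.
move=> s1 h IH; have s0 := ltnW s1.
have sumE : sumn (flatten [seq sg p | p <- ps]) = (\sum_(p <- ps) sumn (sg p))%N.
  by rewrite sumn_flatten -map_comp sumnE big_map.
have lenps : (sumn (map plen ps) = \sum_(p <- ps) sumn (sg p) + size ps)%N.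
  rewrite sumnE big_map -sum1_size -big_split big_seq [RHS]big_seq /=.
  by apply: eq_bigr => p /IH[-> _ _ _]; rewrite addn1.
split.
- by rewrite plen_bsum lenps /= sumE addnC -addSn prednK.
- rewrite inE negb_or eq_sym -lt0n ltn_predRL s1; apply/flattenP => -[_ /mapP[p /IH[_ n0 _ _] ->]].
  exact/negP.
- by apply: separable_bsum => // p /IH[].
have [k sk] : exists k, size ps = k.+1 by exists (size ps).-1; rewrite prednK.
rewrite /= sumE sk /= big_cons evM exprD mulrAC (pop_gf_prod h sk) big_flatten big_map.
set s := (\sum_(p <- ps) _)%N.
(* The formulas of the children are multiplied; their exponents of [point_gf], the lengths of the
   components, add up to the length of the whole. *)
have eF : one_minus_D ^+ s * \prod_(p <- ps) pop_gf (word p) =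
    one_minus_Q ^+ s * ev DQ (\prod_(p <- ps) \prod_(i <- sg p) nar i) * point_gf ^+ (s + size ps).
  rewrite -lenps sumnE big_map ev_prod !expr_sum -!big_split big_seq [RHS]big_seq /=.
  by apply: eq_bigr => p /IH[lp _ _ ->]; rewrite lp.
rewrite [LHS]mulrC mulrCA eF sk addnS [(k + s)%N]addnC !exprD; ring.
Qed.

Lemma Gamma_graph_spec p T : Gamma_graph p T -> tree_spec p (signature T).
Proof.
have node b ps (f : permutation -> dtree) l : (1 < size ps)%N ->
    (forall p, p \in ps -> (0 < plen p)%N /\ ~ gdecomposable b p) ->
    (forall p, p \in ps -> tree_spec p (signature (f p))) ->
    tree_spec (bsum b ps) (signature (Node l [seq f p | p <- ps])).
  move=> s1 ind IH; rewrite /= size_map -map_comp.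
  apply: tree_spec_node => // q /ind[q0 nq]; split=> //.
  by apply: contraT => /gdecomposableP.
elim=> {p T} [|ps f s1 ind _ IH|ps f s1 ind _ IH]; first 1 last.
- exact: (node true).
- exact: (node false).
split=> //; first exact: separable1.
by rewrite word_one big_nil ev1 /= !expr0 !mul1r expr1.
Qed.

Lemma equipopular_pop_gf s t : equipopular s t <-> pop_gf (word s) = pop_gf (word t).
Proof.
split=> [h|h m _].
  (* Equipopularity only speaks of lengths at least 1; at length 0 both coefficients vanish. *)
  apply/funext => -[|m]; first by rewrite /pop_gf /gf seps0 !big_nil.
  by rewrite /pop_gf /gf -!popularityE h.
have := congr1 (fun f : fps => f m) h; rewrite /pop_gf /gf -!popularityE => /eqP.
by rewrite eqr_nat => /eqP.
Qed.

Lemma const_gf phi C : const_term (gf phi C) = 0.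
Proof. by rewrite /const_term /gf seps0 big_nil. Qed.

Lemma const_one_minus_Q : const_term one_minus_Q = 1.
Proof. by rewrite /one_minus_Q const_termD -[X in _ + X]/(- const_term (indec_gf true [::])) const_gf. Qed.

Lemma const_one_plus_S : const_term one_plus_S = 1.
Proof. by rewrite /one_plus_S const_termD const_gf. Qed.

Lemma const_DQ : const_term DQ = 0.
Proof. by rewrite /DQ const_termD const_termX const_one_plus_S expr1n. Qed.

Lemma const_one_minus_D : const_term one_minus_D = 1.
Proof. by rewrite /one_minus_D const_termD -[X in _ + X]/(- const_term DQ) const_DQ. Qed.

(** The length-one permutation contributes to the coefficient of degree one. This serves for the
    empty pattern and for the single point. *)
Lemma pop_gf_neq0 v : (0 < nu v [:: 0%N])%N -> pop_gf v != 0.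
Proof.
move=> v0; apply/eqP => /(congr1 (fun f : fps => f 1%N)) /eqP.
rewrite -[_ == _]/(_%:R == 0%:R :> int) eqr_nat => /eqP /eqP.
have one_in : one_perm \in seps 1.
  by rewrite mem_seps; apply/andP; split=> //; apply/asboolP; exact: separable1.
by rewrite (perm_big _ (perm_to_rem one_in)) big_cons word_one /= addn_eq0 eqn0Ngt v0.
Qed.

Lemma point_gf_neq0 : point_gf != 0.
Proof. exact: pop_gf_neq0. Qed.

Lemma DQ_neq0 : DQ != 0.
Proof.
have S0 : pop_gf [::] != 0 by exact: pop_gf_neq0.
have -> : DQ = pop_gf [::] * (2 + pop_gf [::]) by rewrite /DQ /one_plus_S; ring.
apply/eqP => /fps_mulf_eq0 /(_ S0) /(congr1 const_term).
by rewrite const_termD const_gf.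
Qed.

(** If the series agree, their valuation gives the sum of the signature; then all powers cancel, and
    by transcendence of D the products of Narayana polynomials agree. Conversely the closed formula
    depends on the multiset only, and the power of 1 - D cancels. *)
Lemma signature_indep p q s t : tree_spec p s -> tree_spec q t ->
  pop_gf (word p) = pop_gf (word q) <-> perm_eq s t.
Proof.
have c0 n : one_minus_D ^+ n != 0 by apply/fps_expf_neq0/const_term_neq0; rewrite const_one_minus_D.
have e0 n : one_minus_Q ^+ n != 0 by apply/fps_expf_neq0/const_term_neq0; rewrite const_one_minus_Q.
have psi0 n := fps_expf_neq0 n point_gf_neq0.
have cE (r : seq nat) : const_term (ev DQ (\prod_(k <- r) nar k)) = 1.
  rewrite const_term_ev ?const_DQ // horner_prod big1 // => k _.
  exact: horner0_nar.
(* A strictly larger sum would leave a positive power of [point_gf] on one side only, whose constant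
   term is then 0, while the other side has constant term 1. *)
have le_sumn (p' q' : permutation) s' t' : tree_spec p' s' -> tree_spec q' t' ->
    pop_gf (word p') = pop_gf (word q') -> (sumn t' <= sumn s')%N.
  case=> [_ _ _ es] [_ _ _ et] ep; rewrite leqNgt; apply/negP => lt_st.
  have [d ed] : exists d, sumn t' = (sumn s' + d.+1)%N by exists (sumn t' - sumn s').-1; lia.
  have : one_minus_D ^+ d.+1 * one_minus_Q ^+ sumn s' * ev DQ (\prod_(k <- s') nar k) =
      one_minus_Q ^+ (sumn s' + d.+1) * ev DQ (\prod_(k <- t') nar k) * point_gf ^+ d.+1.
    apply: (fps_mulfI (psi0 (sumn s').+1)).
    transitivity (one_minus_D ^+ sumn t' * pop_gf (word q')).
      by rewrite -ep ed addnC exprD -[RHS]mulrA es; ring.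
    by rewrite et ed -addSn [point_gf ^+ (_ + _)]exprD; ring.
  move=> /(congr1 const_term); rewrite !const_termM !cE !const_termX.
  rewrite const_one_minus_D const_one_minus_Q /point_gf const_gf.
  by rewrite !expr1n expr0n.
move=> ts tt; have [_ s0 _ es] := ts; have [_ t0 _ et] := tt; split=> [ep|pst].
  have est : sumn s = sumn t.
    by apply/eqP; rewrite eqn_leq (le_sumn _ _ _ _ ts tt ep) (le_sumn _ _ _ _ tt ts (esym ep)).
  apply: nar_indep => //; apply: (ev_inj DQ_neq0 const_DQ).
  apply: (fps_mulfI (e0 (sumn s))); apply: (fps_mulfI (psi0 (sumn s).+1)).
  by rewrite [LHS]mulrC [RHS]mulrC -es ep est et.
apply: (fps_mulfI (c0 (sumn s))).
by rewrite es (perm_sumn pst) et (perm_big _ pst).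
Qed.

(** * Existence of decomposition trees *)

Lemma separable_components b p : separable p -> ~~ gindec b (word p) ->
  exists ps, [/\ p = bsum b ps, (1 < size ps)%N, comps b ps & {in ps, forall q, separable q}].
Proof.
have [n] := ubnP (plen p); elim: n p => // n IH p lt_p sp /gdecomposableP/gdecomposable_gindec.
move=> [q [r [q0 r0 iq ep]]]; have [sq sr] : separable q /\ separable r.
  by rewrite ep in sp; exact: separable_gsum_inv sp q0 r0.
have [dr|ir] := boolP (gindec b (word r)).
  exists [:: q; r]; split=> //; first by rewrite bsum_cons bsum1.
  - by move=> x; rewrite !inE => /orP[] /eqP ->.
  - by move=> x; rewrite !inE => /orP[] /eqP ->.
have [|ps [er s1 h hs]] := IH r _ sr ir; first by move: lt_p; rewrite ep plen_gsum; lia.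
exists (q :: ps); split; rewrite ?bsum_cons -?er //=; first exact: ltnW.
- by move=> x; rewrite inE => /predU1P[->|]; [split|exact: h].
- by move=> x; rewrite inE => /predU1P[->|]; [|exact: hs].
Qed.

(** The constructors take a function assigning trees to the components; by induction on the length,
    [Gamma] itself can be that function. *)
Lemma Gamma_graph_Gamma p : separable p -> Gamma_graph p (Gamma p).
Proof.
suff ex : separable p -> exists T, Gamma_graph p T.
  by move=> /ex h; rewrite /Gamma; case: pselect => // h'; exact: svalP (cid h').
have [n] := ubnP (plen p); elim: n p => // n IH p lt_p sp.
have IH' q : separable q -> (plen q < plen p)%N -> Gamma_graph q (Gamma q).
  move=> sq lt_q; rewrite /Gamma; case: pselect => [h|[]]; first exact: svalP (cid h).
  by apply: IH => //; exact: leq_trans lt_q _.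
case: (leqP (plen p) 1) => [le1|gt1].
  exists Leaf; rewrite (@plen1 p); first exact: Gamma_leaf.
  by apply/eqP; rewrite eqn_leq le1 separable_plen.
have [b /gdecomposableP db] := separable_decomposable sp gt1.
have [ps [ep s1 h hs]] := separable_components sp db.
(* Removing one copy of [q] leaves some component of positive length, so [q] is shorter than [p]. *)
have lt_ps q : q \in ps -> (plen q < plen p)%N.
  have : (1 < sumn (map plen ps))%N by rewrite -(plen_bsum b) -ep.
  move=> _ qps; rewrite ep plen_bsum (perm_sumn (perm_map plen (perm_to_rem qps))) /=.
  have : (0 < size (rem q ps))%N by rewrite size_rem //; case: (size ps) s1.
  have : {subset rem q ps <= ps} by exact: mem_rem.
  case: (rem q ps) => // r s sub _ /=; have [r0 _] := h r (sub _ (mem_head _ _)).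
  by move: (plen _) (plen _) (sumn _) r0 => x y z; lia.
have gr q : q \in ps -> Gamma_graph q (Gamma q).
  by move=> qps; apply: IH'; [exact: hs|exact: lt_ps].
have ind q : q \in ps -> (0 < plen q)%N /\ ~ gdecomposable b q.
  by move=> /h[q0 iq]; split=> // /gdecomposableP; rewrite iq.
rewrite ep; case: b {db h ep} ind => ind.
  by exists (Node Oplus [seq Gamma q | q <- ps]); exact: Gamma_oplus.
by exists (Node Ominus [seq Gamma q | q <- ps]); exact: Gamma_ominus.
Qed.

(** For [p = q] this shows that any two trees of one permutation have the same signature up to
    order. *)
Lemma equipopular_Gamma_graph p q T U : Gamma_graph p T -> Gamma_graph q U ->
  equipopular p q <-> perm_eq (signature T) (signature U).
Proof.
move=> /Gamma_graph_spec hT /Gamma_graph_spec hU.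
by rewrite equipopular_pop_gf; exact: signature_indep.
Qed.

Lemma gindec_one b : gindec b (word one_perm).
Proof. by rewrite word_one. Qed.

(** A caterpillar realizes [l]: the node for [k] has as children the tree built for the rest of the
    list and [k] leaves. The last clause of the statement keeps the induction going: it provides a
    sign for the new node and separates [p] from the leaves. *)
Lemma signature_surj l : 0%N \notin l -> exists p T,
  [/\ Gamma_graph p T, signature T = l & (p = one_perm /\ T = Leaf) \/
    exists b, gdecomposable b p].
Proof.
elim: l => [_|k l IH]; first by exists one_perm, Leaf; split; [exact: Gamma_leaf| |left].
rewrite inE negb_or eq_sym -lt0n => /andP[k0 /IH[p [T [gT sT hp]]]].
(* Trees are assigned to permutations and not to positions, so [p] may equal [one_perm] only when
   [T] is [Leaf]. *)
pose f q := if q == one_perm then Leaf else T.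
have fp : f p = T.
  rewrite /f; case: eqP => // p1; case: hp => [[_ ->] //|[b [q [r [q0 r0 ep]]]]].
  by have := congr1 plen ep; rewrite p1 plen_gsum => /= e1; exfalso; move: q0 r0 e1; lia.
(* A single point is indecomposable for both signs; otherwise the sign opposite to a decomposition
   of [p] works. *)
have [b [p0 ip]] : exists b, (0 < plen p)%N /\ ~ gdecomposable b p.
  have [lp _ _ _] := Gamma_graph_spec gT; rewrite lp.
  case: hp => [[-> _]|[b /gdecomposableP /gindec_excl nb]].
    by exists true; split=> // /gdecomposableP; rewrite gindec_one.
  by exists (~~ b); split=> // /gdecomposableP; rewrite nb.
pose ps := p :: nseq k one_perm.
have s1 : (1 < size ps)%N by rewrite /= size_nseq.
have ind q : q \in ps -> (0 < plen q)%N /\ ~ gdecomposable b q.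
  rewrite inE mem_nseq => /orP[/eqP -> //|/andP[_ /eqP ->]].
  by split=> // /gdecomposableP; rewrite gindec_one.
have gr q : q \in ps -> Gamma_graph q (f q).
  rewrite inE mem_nseq => /orP[/eqP ->|/andP[_ /eqP ->]]; first by rewrite fp.
  by rewrite /f eqxx; exact: Gamma_leaf.
have sig lb : signature (Node lb [seq f q | q <- ps]) = k :: l.
  rewrite /= fp size_map size_nseq sT map_nseq /f eqxx; congr (_ :: _).
  have -> : flatten [seq signature U | U <- nseq k Leaf] = [::] by elim: (k).
  by rewrite cats0.
have dec : gdecomposable b (bsum b ps).
  apply/gdecomposableP; apply: bsum_dec => // q /ind[q0 nq]; split=> //.
  by apply: contraT => /gdecomposableP.
case: b {ip} ind dec => ind dec.
  exists (bsum true ps), (Node Oplus [seq f q | q <- ps]).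
  by split; [exact: Gamma_oplus|exact: sig|right; exists true].
exists (bsum false ps), (Node Ominus [seq f q | q <- ps]).
by split; [exact: Gamma_ominus|exact: sig|right; exists false].
Qed.

(* Equipopularity classes and integer partitions *)
Local Close Scope ring_scope.

Theorem theorem4p7 :
  (forall s t : permutation, separable s -> separable t ->
     (equipopular s t <-> perm_eq (signature (Gamma s)) (signature (Gamma t)))) /\
  (forall n : nat, 1 <= n ->
     exists f : seq nat -> set permutation,
       set_bij (int_partitions (n - 1)) (equipop_classes n) f).
Proof.
have part1 s t : separable s -> separable t ->
    (equipopular s t <-> perm_eq (signature (Gamma s)) (signature (Gamma t))).
  by move=> /Gamma_graph_Gamma gs /Gamma_graph_Gamma gt; exact: equipopular_Gamma_graph.
split=> // n n1.
(* A representative [g l] is chosen for every list; lists containing 0 get the dummy value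
   [one_perm]. *)
have /choice[g gP] (l : seq nat) : exists p, 0 \notin l ->
    [/\ separable p, plen p = (sumn l).+1 & perm_eq (signature (Gamma p)) l].
  case: (boolP (0 \in l)) => [|l0]; first by exists one_perm.
  have [p [T [gT sT _]]] := signature_surj l0; exists p => _.
  have [lp _ sp _] := Gamma_graph_spec gT; split=> //; first by rewrite lp sT.
  by rewrite -sT; apply/(equipopular_Gamma_graph (Gamma_graph_Gamma sp) gT).
exists (fun l => equipop_class (g l)); split.
- move=> l [_ l0 sl]; have [sp lp _] := gP l l0; exists (g l) => //.
  by split=> //; rewrite lp sl subn1 prednK.
(* Equal classes make the two representatives equipopular, so [l] and [l'] have the same multiset of
   entries, and both are sorted. *)
- move=> l l'; rewrite !inE => -[lsort l0 sl] [l'sort l'0 sl'] ecl.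
  have [sp _ pl] := gP l l0; have [sp' _ pl'] := gP l' l'0.
  have [_ /part1] : equipop_class (g l) (g l') by rewrite ecl; split.
  move=> /(_ sp sp') pe; apply: (sorted_eq (leT := geq)) => //.
  + by move=> x y z /= yx xz; exact: leq_trans xz yx.
  + by move=> x y /andP[] /= yx xy; apply/eqP; rewrite eqn_leq xy.
  + by rewrite perm_sym in pl; exact: perm_trans pl (perm_trans pe pl').
move=> _ [p [sp lp] <-].
(* The preimage of the class of [p] is its signature in weakly decreasing order. *)
pose l := sort geq (signature (Gamma p)).
have [lp' s0 _ _] := Gamma_graph_spec (Gamma_graph_Gamma sp).
have l0 : 0 \notin l by rewrite mem_sort.
exists l.
  split=> //; first by apply: sort_sorted => x y; exact: leq_total.
  by rewrite (perm_sumn (permEl (perm_sort _ _))) -lp lp' subn1.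
have [sg lg pg] := gP l l0.
have eqv : equipopular (g l) p by apply/part1 => //; rewrite (perm_trans pg) // perm_sort.
apply/seteqP; split=> q [sq hq]; split=> // m m1; first by rewrite -eqv ?hq.
by rewrite eqv ?hq.
Qed.
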